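(* There is an absolute constant $C>0$ such that the following holds. Let $n\ge 1$, $d\ge 2$ and $m\ge 6n$ be integers. Let $q_0,\dots,q_{d-1}\in\{0,1\}^n$ be pairwise distinct and let $\alpha_0,\dots,\alpha_{d-1}\in\mathbb{C}$ satisfy $\sum_{i=0}^{d-1}|\alpha_i|^2=1$. Then there is a quantum circuit $U$ acting on $n+m$ qubits such that $$U\,|0\rangle^{\otimes n}|0\rangle^{\otimes m}=\sum_{i=0}^{d-1}\alpha_i\,|q_i\rangle\,|0\rangle^{\otimes m},$$ whose depth is at most $C\left(\frac{nd\log m}{m\log(m/n)}+\log(nd)\right)$ and whose size is at most $C\left(\frac{nd}{\log(m/n)}+\frac{nd}{\log d}\right)$.
   Context: All logarithms are base 2. Quantum circuits are built from arbitrary single-qubit unitary gates and CNOT gates. The size of a circuit is its number of gates; its depth is the minimum number of layers into which the gates can be arranged so that the gates within a layer act on pairwise disjoint qubits. The $m$ extra qubits are ancillary qubits: they start in $|0\rangle$ and must be returned to $|0\rangle$. *)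

(* Defs.v *)
From Stdlib Require Import Reals.
From HB Require Import structures.
From mathcomp Require Import all_boot all_algebra.
From mathcomp Require Import complex Rstruct.
From Stdlib Require List.
Set Implicit Arguments. Unset Strict Implicit. Unset Printing Implicit Defensive.
Import GRing.Theory Num.Theory.
Local Open Scope ring_scope.

Definition CC : Type := (R[i])%type.

Definition bits (N : nat) := {ffun 'I_N -> bool}.
Definition state (N : nat) := bits N -> CC.

(* a 2x2 matrix u (row a, column b, indices in bool = {|0>,|1>}) is unitary: u u^dagger = I *)
Definition unitary2 (u : bool -> bool -> CC) : Prop :=
  forall a b : bool, \sum_(c : bool) u a c * (u b c)^* = (a == b)%:R.

(* gates: an arbitrary single-qubit gate u on qubit i, or CNOT with control c, target t *)
Inductive gate (N : nat) : Type :=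
| G1 of 'I_N & (bool -> bool -> CC)
| CNOT of 'I_N & 'I_N.

Definition gate_ok N (g : gate N) : Prop :=
  match g with
  | G1 _ u => unitary2 u
  | CNOT c t => c <> t
  end.

Definition qubits N (g : gate N) : seq 'I_N :=
  match g with
  | G1 i _ => [:: i]
  | CNOT c t => [:: c; t]
  end.

Definition setbit N (x : bits N) (i : 'I_N) (b : bool) : bits N :=
  [ffun k => if k == i then b else x k].

Definition apply_gate N (g : gate N) (psi : state N) : state N :=
  match g with
  | G1 i u => fun x => \sum_(b : bool) u (x i) b * psi (setbit x i b)
  | CNOT c t => fun x => psi (setbit x t (x t (+) x c))
  end.

Definition circuit N := seq (gate N).

Definition run N (c : circuit N) (psi : state N) : state N :=
  foldl (fun s g => apply_gate g s) psi c.

Definition circuit_ok N (c : circuit N) : Prop := List.Forall (@gate_ok N) c.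

Definition csize N (c : circuit N) : nat := size c.

Definition ket N (y : bits N) : state N := fun x => (x == y)%:R.

Definition zeros N : bits N := [ffun => false].

Definition join n m (a : bits n) (b : bits m) : bits (n + m) :=
  [ffun k : 'I_(n + m) => match fintype.split k with inl i => a i | inr j => b j end].

Definition gates_overlap N (g h : gate N) : bool :=
  has (fun i => i \in qubits h) (qubits g).

(* f arranges the gates of c into D layers 0..D-1 (gate k goes to layer f k),
   respecting the order of the circuit: any two gates sharing a qubit lie in
   different layers, the earlier one in an earlier layer (so gates in a layer act
   on pairwise disjoint qubits). *)
Definition layering N (c : circuit N) (D : nat) (f : nat -> nat) : Prop :=
  (forall k : nat, (k < size c)%N -> (f k < D)%N) /\
  (forall (j k : nat) (g h : gate N), (j < k)%N -> onth c j = Some g -> onth c k = Some h ->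
     gates_overlap g h -> (f j < f k)%N).

Definition depth_le N (c : circuit N) (D : nat) : Prop := exists f, layering c D f.

Definition log2 (x : R) : R := (ln x / ln 2)%R.

(* Main.v *)
Require Import Defs.
From Stdlib Require Import Reals FunctionalExtensionality.
From HB Require Import structures.
From mathcomp Require Import all_boot all_order all_algebra.
From mathcomp Require Import complex Rstruct.
From mathcomp Require Import ring lra zify.
Set Implicit Arguments. Unset Strict Implicit. Unset Printing Implicit Defensive.
Import Order.TTheory GRing.Theory Num.Theory.
Local Open Scope ring_scope.

(* The register is extended by a flag qubit, and [|0>|flag>] plays the role of
   the amplitude not yet distributed; the items [q_i] are loaded in batches of
   [k].  In a batch, a tree of amplitude splittings turns the excitation of the
   flag into a superposition of one-hot indices [e_i] (and a smaller excitation
   of the flag); then [q_i] is XORed into the register under the control of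
   [e_i], and finally [e_i] is erased by comparing the register with [q_i],
   which cannot disturb the items loaded before since the [q_i] are distinct.
   To save a factor [s] in the last two steps, the register is cut into blocks
   of [s] bits and both pass through the one-hot encodings of the blocks: there
   are [2^s] words per block, and [e_i] is linked to a single word of each of
   the [n/s] blocks, so that a batch costs [O(nk/s + n 2^s)] gates, in depth
   logarithmic in that number.  Taking [2^s] near [sqrt(m/n)] and [k] near
   [s m/n] fills the ancillas and balances the two terms; when [m/n] is bounded,
   [k = 1] without any block encoding fits in the [6n] ancillas. *)

(** * Gates and superpositions *)

Section Gates.
Variable N : nat.
Implicit Types (y x : bits N) (i j : 'I_N) (psi phi : state N) (z w : CC).

(** A qubit takes part in one gate per layer, so logarithmic depth forces a value read by many gates
    to be copied first, and the inputs of a parity or a conjunction to be gathered along a tree.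
    Copies and partial results must then return to 0; each such step is therefore a preparation, a
    write to qubits that the preparation avoids, and the reversed preparation. All of this permutes
    basis states, so it is checked on Boolean assignments; only the splitting of amplitudes needs
    complex numbers, and linearity joins the two. The flag counts as a bit of the register: the
    undistributed state then differs from every item and passes unharmed through the comparisons. As
    for the two summands in each bound: if a single batch suffices, only the depth of its trees
    remains, which gives [log(nd)]; and the ratio [m/n] is exploited only up to a multiple of [d],
    so that [s] is of order [log(m/n)] or [log d], whence the two terms of the size. *)

Definition scl z psi : state N := fun x => z * psi x.
Definition add psi phi : state N := fun x => psi x + phi x.

Lemma setbit_id y i : setbit y i (y i) = y.
Proof. by apply/ffunP => k; rewrite ffunE; case: eqP => [->|]. Qed.

Lemma setbitE y i b k : setbit y i b k = if k == i then b else y k.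
Proof. by rewrite ffunE. Qed.

Lemma setbit_setbit y i b b' : setbit (setbit y i b) i b' = setbit y i b'.
Proof. by apply/ffunP => k; rewrite !ffunE; case: eqP. Qed.

Lemma run_cat (c1 c2 : circuit N) psi : run (c1 ++ c2) psi = run c2 (run c1 psi).
Proof. exact: foldl_cat. Qed.

Lemma scl_scl z w psi : scl z (scl w psi) = scl (z * w) psi.
Proof. by apply: functional_extensionality => x; rewrite /scl mulrA. Qed.

Lemma scl1 psi : scl 1 psi = psi.
Proof. by apply: functional_extensionality => x; rewrite /scl mul1r. Qed.

Lemma scl0 psi : scl 0 psi = fun=> 0.
Proof. by apply: functional_extensionality => x; rewrite /scl mul0r. Qed.

Lemma scl_add z psi phi : scl z (add psi phi) = add (scl z psi) (scl z phi).
Proof. by apply: functional_extensionality => x; rewrite /scl /add mulrDr. Qed.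

Lemma apply_gate_scl g z psi : apply_gate g (scl z psi) = scl z (apply_gate g psi).
Proof.
apply: functional_extensionality => x; case: g => [i u|c t] //=.
by rewrite /scl mulr_sumr; apply: eq_bigr => b _; rewrite mulrCA.
Qed.

Lemma apply_gate_add g psi phi :
  apply_gate g (add psi phi) = add (apply_gate g psi) (apply_gate g phi).
Proof.
apply: functional_extensionality => x; case: g => [i u|c t] //=.
by rewrite /add -big_split; apply: eq_bigr => b _; rewrite mulrDr.
Qed.

Lemma run_scl (c : circuit N) z psi : run c (scl z psi) = scl z (run c psi).
Proof. by elim: c psi => //= g c IH psi; rewrite apply_gate_scl IH. Qed.

Lemma run_add (c : circuit N) psi phi :
  run c (add psi phi) = add (run c psi) (run c phi).
Proof. by elim: c psi phi => //= g c IH psi phi; rewrite apply_gate_add IH. Qed.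

Lemma run0 (c : circuit N) : run c (fun=> 0) = fun=> 0.
Proof. by rewrite -(scl0 (fun=> 0)) run_scl !scl0. Qed.

Definition superpose (I : Type) (r : seq I) (P : pred I) (a : I -> CC)
  (Psi : I -> state N) : state N := fun x => \sum_(k <- r | P k) a k * Psi k x.

Lemma superpose_cons (I : Type) k (r : seq I) (P : pred I) a Psi :
  superpose (k :: r) P a Psi =
  if P k then add (scl (a k) (Psi k)) (superpose r P a Psi) else superpose r P a Psi.
Proof.
by apply: functional_extensionality => x; rewrite /superpose big_cons; case: ifP.
Qed.

Lemma superpose_nil (I : Type) (P : pred I) a Psi :
  superpose [::] P a Psi = fun=> 0.
Proof. by apply: functional_extensionality => x; rewrite /superpose big_nil. Qed.

Lemma superpose_cat (I : Type) (r1 r2 : seq I) (P : pred I) a Psi :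
  superpose (r1 ++ r2) P a Psi = add (superpose r1 P a Psi) (superpose r2 P a Psi).
Proof. by apply: functional_extensionality => x; rewrite /superpose big_cat. Qed.

Lemma run_superpose (c : circuit N) (I : Type) (r : seq I) (P : pred I) a Psi :
  run c (superpose r P a Psi) = superpose r P a (fun k => run c (Psi k)).
Proof.
elim: r => [|k r IH]; first by rewrite !superpose_nil run0.
by rewrite !superpose_cons; case: ifP => // _; rewrite run_add run_scl IH.
Qed.

Lemma eq_superpose (I : eqType) (r : seq I) (P : pred I) a Psi Phi :
  (forall k, k \in r -> P k -> Psi k = Phi k) ->
  superpose r P a Psi = superpose r P a Phi.
Proof.
move=> E; apply: functional_extensionality => x; rewrite /superpose.
by rewrite big_seq_cond [RHS]big_seq_cond; apply: eq_bigr => k /andP[kr Pk]; rewrite E.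
Qed.

Lemma apply_G1_ket i u y :
  apply_gate (G1 i u) (ket y) =
  add (scl (u false (y i)) (ket (setbit y i false)))
      (scl (u true (y i)) (ket (setbit y i true))).
Proof.
apply: functional_extensionality => x.
rewrite /= /add /scl /ket big_bool addrC.
have E b : (setbit x i b == y) = (b == y i) && (x == setbit y i (x i)).
  apply/eqP/andP => [<-|[/eqP -> /eqP ->]].
    by rewrite setbitE eqxx setbit_setbit setbit_id.
  by rewrite setbit_setbit setbit_id.
rewrite !E.
have F b : (x == setbit y i b) = (x i == b) && (x == setbit y i (x i)).
  apply/eqP/andP => [->|[/eqP <- /eqP //]].
  by rewrite setbitE eqxx.
rewrite !(F true) !(F false).
by case: (x i); case: (y i); case: (x == _); rewrite /= ?mulr0 ?mulr1 ?addr0 ?add0r.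
Qed.

Lemma apply_CNOT_ket c t y : c <> t ->
  apply_gate (CNOT c t) (ket y) = ket (setbit y t (y t (+) y c)).
Proof.
move=> ct; apply: functional_extensionality => x; rewrite /= /ket; congr (_%:R).
have E : (c == t) = false by apply/eqP.
congr nat_of_bool; apply/eqP/eqP => [<-|->].
  by rewrite setbit_setbit !setbitE eqxx E addbK setbit_id.
by rewrite setbit_setbit !setbitE eqxx E addbK setbit_id.
Qed.

(** * Elementary matrices and the Toffoli gate *)

Definition uX (a b : bool) : CC := (a != b)%:R.
Definition uP z (a b : bool) : CC := if a == b then (if a then z else 1) else 0.
Definition isqrt2 : CC := (sqrtC 2)^-1.
Definition uH (a b : bool) : CC := if a && b then - isqrt2 else isqrt2.

Lemma isqrt2_sqr : isqrt2 * isqrt2 = 2^-1.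
Proof. by rewrite -invfM -expr2 sqrtCK. Qed.

Lemma isqrt2_conj : isqrt2^* = isqrt2.
Proof. by apply: CrealP; rewrite ger0_real // invr_ge0 sqrtC_ge0. Qed.

Lemma uX_unitary : unitary2 uX.
Proof. by case=> [] []; rewrite big_bool /uX /= ?conjC0 ?conjC1; ring. Qed.

Lemma uP_unitary z : `|z| = 1 -> unitary2 (uP z).
Proof.
move=> hz; case=> [] []; rewrite big_bool /uP /= ?conjC0 ?conjC1 ?mulr0 ?mul0r ?addr0 ?add0r ?mulr1 //.
by rewrite -normCK hz expr1n.
Qed.

Lemma uH_unitary : unitary2 uH.
Proof.
case=> [] []; rewrite big_bool /uH /= ?rmorphN /= isqrt2_conj ?mulrN ?mulNr ?opprK isqrt2_sqr; field; rewrite ?pnatr_eq0 ?oner_eq0 //.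
Qed.

Lemma apply_X_ket i y : apply_gate (G1 i uX) (ket y) = ket (setbit y i (~~ y i)).
Proof.
rewrite apply_G1_ket; apply: functional_extensionality => x; rewrite /add /scl /uX.
by case: (y i); rewrite /= ?mul0r ?mul1r ?addr0 ?add0r.
Qed.

Lemma apply_P_ket i z y :
  apply_gate (G1 i (uP z)) (ket y) = scl (if y i then z else 1) (ket y).
Proof.
transitivity (scl (if y i then z else 1) (ket (setbit y i (y i)))); last by rewrite setbit_id.
rewrite apply_G1_ket; apply: functional_extensionality => x; rewrite /add /scl /uP.
by case: (y i); rewrite /= ?mul0r ?addr0 ?add0r.
Qed.

#[local] Arguments apply_gate : simpl never.

Lemma apply_P_scl_ket i z w y :
  apply_gate (G1 i (uP z)) (scl w (ket y)) = scl (w * if y i then z else 1) (ket y).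
Proof. by rewrite apply_gate_scl apply_P_ket scl_scl. Qed.

Lemma apply_CNOT_scl_ket c t w y : c <> t ->
  apply_gate (CNOT c t) (scl w (ket y)) = scl w (ket (setbit y t (y t (+) y c))).
Proof. by move=> ct; rewrite apply_gate_scl apply_CNOT_ket. Qed.

Definition omega8 : CC := sqrtC 'i.

Lemma omega8_4 : omega8 ^+ 4 = -1.
Proof. by rewrite (exprM _ 2 2) sqrtCK sqrCi. Qed.

Lemma omega8_neq0 : omega8 != 0.
Proof. by apply/eqP => h; have := omega8_4; rewrite h expr0n /=; move/eqP; rewrite eq_sym oppr_eq0 oner_eq0. Qed.

Lemma omega8_norm : `|omega8| = 1.
Proof.
by apply/eqP; rewrite -(@pexpr_eq1 _ _ 4) // -normrX omega8_4 normrN1.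
Qed.

Lemma omega8V_norm : `|omega8^-1| = 1.
Proof. by rewrite normfV omega8_norm invr1. Qed.

(** Between the two CNOTs the target holds the parity of both bits, so a single-qubit phase acts on
    that parity; the second CNOT undoes the first. *)
Lemma run_parity_phase c t z w y : c <> t ->
  run [:: CNOT c t; G1 t (uP z); CNOT c t] (scl w (ket y)) =
  scl (w * if y t (+) y c then z else 1) (ket y).
Proof.
move=> ct; have E : (c == t) = false by apply/eqP.
rewrite /run /= !(apply_CNOT_scl_ket, apply_P_scl_ket) //.
by rewrite setbit_setbit !setbitE eqxx E addbK setbit_id.
Qed.

(* The phase is omega^(a + b + t - (a(+)b) - (a(+)t) - (b(+)t) + (a(+)b(+)t)) = omega^(4abt). *)
Definition ccz (a b t : 'I_N) : circuit N :=
  [:: G1 a (uP omega8); G1 b (uP omega8); G1 t (uP omega8)] ++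
  [:: CNOT a b; G1 b (uP omega8^-1); CNOT a b] ++
  [:: CNOT a t; G1 t (uP omega8^-1); CNOT a t] ++
  [:: CNOT b t; G1 t (uP omega8^-1); CNOT b t] ++
  [:: CNOT b t] ++ [:: CNOT a t; G1 t (uP omega8); CNOT a t] ++ [:: CNOT b t].

Lemma uniq3 (T : eqType) (a b t : T) : uniq [:: a; b; t] -> [/\ a <> b, a <> t & b <> t].
Proof.
rewrite /= !inE negb_or andbT => /andP[/andP[/eqP ab /eqP aT] /eqP bt]; by split.
Qed.

Lemma run_ccz a b t y : uniq [:: a; b; t] ->
  run (ccz a b t) (ket y) = scl (if [&& y a, y b & y t] then -1 else 1) (ket y).
Proof.
move=> /uniq3[ab aT bt].
have E : (b == t) = false by apply/eqP.
have F : (a == t) = false by apply/eqP.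
have w0 := omega8_neq0; have w4 := omega8_4.
rewrite -[ket y in LHS]scl1 /ccz. rewrite !run_cat.
have -> : run [:: G1 a (uP omega8); G1 b (uP omega8); G1 t (uP omega8)] (scl 1 (ket y)) =
  scl (1 * (if y a then omega8 else 1) * (if y b then omega8 else 1) *
      (if y t then omega8 else 1)) (ket y).
  by rewrite /run /= !apply_P_scl_ket.
have C1 w y' : run [:: CNOT b t] (scl w (ket y')) = scl w (ket (setbit y' t (y' t (+) y' b))).
  exact: apply_CNOT_scl_ket.
rewrite !run_parity_phase // C1 run_parity_phase // C1.
rewrite setbit_setbit !setbitE eqxx E F addbK setbit_id; congr (scl _ _).
(* The phases cancel unless all three bits are set; then every parity of two bits is 0 and the four
   positive phases multiply to [omega8 ^+ 4]. *)
case: (y a); case: (y b); case: (y t); rewrite /= ?mul1r ?mulr1 -?w4; by field.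
Qed.

Definition ccx (a b t : 'I_N) : circuit N :=
  G1 t uH :: ccz a b t ++ [:: G1 t uH].

(** Conjugation by the Hadamard gate on [t] turns the controlled sign into a controlled flip. *)
Lemma run_ccx a b t y : uniq [:: a; b; t] ->
  run (ccx a b t) (ket y) = ket (setbit y t (y t (+) (y a && y b))).
Proof.
move=> U; have [ab aT bt] := uniq3 U.
have E : (b == t) = false by apply/eqP.
have F : (a == t) = false by apply/eqP.
have run1 g psi : run [:: g] psi = apply_gate g psi by [].
rewrite /ccx -cat1s run_cat (run_cat (ccz _ _ _)) !run1 apply_G1_ket run_add !run_scl !run_ccz //.
rewrite !setbitE eqxx E F.
rewrite apply_gate_add !apply_gate_scl !apply_G1_ket !setbit_setbit !setbitE eqxx.
have q := isqrt2_sqr.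
apply: functional_extensionality => x; rewrite /add /scl /uH.
(* This makes both sides quadratic in [isqrt2], and [ring] closes the eight cases without its
   value. *)
have q2 : isqrt2 * isqrt2 + isqrt2 * isqrt2 = 1 by rewrite q; field.
rewrite -[RHS]mul1r -[X in _ = X * _]q2.
by case: (y a); case: (y b); case: (y t); rewrite /=; ring.
Qed.

(* [tilt b] is orthogonal and conjugates X to a reflection with first column
   (sqrt(1 - b^2), b); a CNOT conjugated by it is thus a controlled reflection. *)
Definition tilt (b : CC) (r k : bool) : CC :=
  if r == k then sqrtC ((1 + b) / 2)
  else if r then - sqrtC ((1 - b) / 2) else sqrtC ((1 - b) / 2).

(** The first three gates form the controlled reflection, which excites [c] with amplitude [b] when
    [p] is excited; the last CNOT then clears [p] in that branch, so that the excitation moves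
    instead of being doubled. *)
Definition amp_split (p c : 'I_N) (b : CC) : circuit N :=
  [:: G1 c (fun r k => tilt b k r); CNOT p c; G1 c (tilt b); CNOT c p].

Section AmpSplit.
Variables (p c : 'I_N) (b : CC).
Hypotheses (b0 : 0 <= b) (b1 : b <= 1).

Let cs := sqrtC ((1 + b) / 2).
Let sn := sqrtC ((1 - b) / 2).

Let cs0 : 0 <= cs.
Proof. by rewrite sqrtC_ge0 divr_ge0 // addr_ge0. Qed.

Let sn0 : 0 <= sn.
Proof. by rewrite sqrtC_ge0 divr_ge0 // subr_ge0. Qed.

Let cs2 : cs * cs = (1 + b) / 2.
Proof. by rewrite -expr2 sqrtCK. Qed.

Let sn2 : sn * sn = (1 - b) / 2.
Proof. by rewrite -expr2 sqrtCK. Qed.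

Lemma tilt_conj r k : (tilt b r k)^* = tilt b r k.
Proof.
rewrite /tilt -/cs -/sn; have [ec es] : cs^* = cs /\ sn^* = sn.
  by split; apply: CrealP; rewrite ger0_real.
by case: eqP => _ //; case: r => //; rewrite rmorphN /= es.
Qed.

Lemma tilt_unitary : unitary2 (tilt b).
Proof.
move=> r k; rewrite big_bool !tilt_conj /tilt -/cs -/sn.
case: r k => [] [] /=; rewrite ?mulrNN ?cs2 ?sn2; try ring; field.
all: by [].
Qed.

Lemma tilt_tr_unitary : unitary2 (fun r k => tilt b k r).
Proof.
move=> r k; rewrite big_bool !tilt_conj /tilt -/cs -/sn.
case: r k => [] [] /=; rewrite ?mulrNN ?cs2 ?sn2; try ring; field.
all: by [].
Qed.

Lemma tilt_cross : 2 * (cs * sn) = sqrtC (1 - b ^+ 2).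
Proof.
rewrite -[LHS]sqrCK ?mulr_ge0 //; congr sqrtC.
rewrite !exprMn (expr2 cs) (expr2 sn) cs2 sn2; field; exact: isT.
Qed.

Lemma run_amp_split y : p <> c -> y c = false ->
  run (amp_split p c b) (ket y) =
  if y p then add (scl (sqrtC (1 - b ^+ 2)) (ket y))
                  (scl b (ket (setbit (setbit y p false) c true)))
  else ket y.
Proof.
move=> pc yc; have cp : c <> p by move=> e; exact: pc.
have E : (p == c) = false by apply/eqP.
have E' : (c == p) = false by apply/eqP.
rewrite /amp_split /run /= apply_G1_ket yc !apply_gate_add !apply_gate_scl.
rewrite !apply_CNOT_ket // !setbitE eqxx E !setbit_setbit !apply_G1_ket !setbitE eqxx !setbit_setbit.
rewrite !apply_gate_add !apply_gate_scl !apply_CNOT_ket // !setbitE eqxx E ?E'.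
rewrite -tilt_cross /tilt -/cs -/sn /=.
have y0 : setbit y c false = y by rewrite -yc setbit_id.
have S b' : setbit (setbit y c b') p (y p) = setbit y c b'.
  by apply/ffunP => k; rewrite !ffunE; case: (k =P p) => // ->; rewrite E.
apply: functional_extensionality => x; rewrite /add /scl.
have ycs : cs * cs + sn * sn = 1 by rewrite cs2 sn2; field; exact: isT.
have yd : cs * cs - sn * sn = b by rewrite cs2 sn2; field; exact: isT.
case yp : (y p) S => S; rewrite /= ?S y0.
  have -> : setbit (setbit y c true) p false = setbit (setbit y p false) c true.
    apply/ffunP => k; rewrite !ffunE.
    by case: (k =P p) => // ->; rewrite E.
  by rewrite -yd; ring.
by rewrite -[RHS]mul1r -[X in _ = X * _]ycs; ring.
Qed.

Lemma amp_split_ok : p <> c -> circuit_ok (amp_split p c b).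
Proof.
move=> pc; rewrite /amp_split; do ! constructor => //=.
- exact: tilt_tr_unitary.
- exact: tilt_unitary.
by move=> e; exact: pc.
Qed.
End AmpSplit.

Lemma ccx_ok a b t : uniq [:: a; b; t] -> circuit_ok (ccx a b t).
Proof.
move=> /uniq3[ab aT bt]; rewrite /ccx /ccz /=.
do ! constructor => //=;
  first [exact: uH_unitary | apply: uP_unitary; first [exact: omega8_norm | exact: omega8V_norm]].
Qed.
End Gates.
(** * Depth *)

Section Depth.
Variable N : nat.
Implicit Types c : circuit N.

Definition csupp c : seq 'I_N := flatten (map (@qubits N) c).

Lemma csupp_cat c1 c2 : csupp (c1 ++ c2) = csupp c1 ++ csupp c2.
Proof. by rewrite /csupp map_cat flatten_cat. Qed.

Lemma onth_sub_csupp c k g q : onth c k = Some g -> q \in qubits g -> q \in csupp c.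
Proof.
elim: c k => [|h c IH] [|k] //=; rewrite /csupp /= -/(csupp c) mem_cat.
  by move=> -[->] ->.
by move=> ck qg; rewrite (IH k) ?orbT.
Qed.

Lemma depth_leW c D D' : depth_le c D -> (D <= D')%N -> depth_le c D'.
Proof.
by move=> [f [f1 f2]] le; exists f; split => // k /f1 h; exact: leq_trans le.
Qed.

Lemma depth_le_size c : depth_le c (size c).
Proof. by exists id; split. Qed.

Lemma onth_cat_split c1 c2 k g : onth (c1 ++ c2) k = Some g ->
  if (k < size c1)%N then onth c1 k = Some g else onth c2 (k - size c1) = Some g.
Proof. by rewrite onth_cat; case: ifP. Qed.

Lemma depth_le_cat c1 c2 D1 D2 :
  depth_le c1 D1 -> depth_le c2 D2 -> depth_le (c1 ++ c2) (D1 + D2)%N.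
Proof.
move=> [f [f1 f2]] [g [g1 g2]].
exists (fun k => if (k < size c1)%N then f k else D1 + g (k - size c1))%N; split.
  move=> k; rewrite size_cat; case: (ltnP k (size c1)) => [lt _|ge lt].
    by apply: leq_trans (f1 _ lt) _; exact: leq_addr.
  by rewrite ltn_add2l g1 // ltn_subLR.
move=> j k x y jk /onth_cat_split cj /onth_cat_split ck ov.
case: ltnP cj => [j1|j1] cj; case: ltnP ck => [k1|k1] ck.
- exact: f2 cj ck ov.
- by apply: leq_trans (f1 _ j1) _; exact: leq_addr.
- by have := leq_ltn_trans j1 (ltn_trans jk k1); rewrite ltnn.
- by rewrite ltn_add2l; apply: g2 cj ck ov; rewrite ltn_sub2r // (leq_ltn_trans j1).
Qed.

Lemma depth_le_par c1 c2 D : ~~ has (mem (csupp c1)) (csupp c2) ->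
  depth_le c1 D -> depth_le c2 D -> depth_le (c1 ++ c2) D.
Proof.
move=> dis [f [f1 f2]] [g [g1 g2]].
exists (fun k => if (k < size c1)%N then f k else g (k - size c1))%N; split.
  move=> k; rewrite size_cat; case: (ltnP k (size c1)) => [lt _|ge lt]; first exact: f1.
  by rewrite g1 // ltn_subLR.
move=> j k x y jk /onth_cat_split cj /onth_cat_split ck ov.
case: ltnP cj => [j1|j1] cj; case: ltnP ck => [k1|k1] ck.
- exact: f2 cj ck ov.
- case/hasP: ov => q qx qy; case/hasP: dis; exists q.
    exact: onth_sub_csupp ck qy.
  exact: onth_sub_csupp cj qx.
- by have := leq_ltn_trans j1 (ltn_trans jk k1); rewrite ltnn.
- by apply: g2 cj ck ov; rewrite ltn_sub2r // (leq_ltn_trans j1).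
Qed.
End Depth.

(** * Reversible circuits over an abstract set of qubits *)

(** These gates permute basis states, so circuits made of them can be verified on Boolean functions
    over any finite type of qubits; sum types then give each group of ancillas its own constructor,
    and numbers are assigned only at compilation. *)
Inductive op (Q : Type) : Type :=
| OX of Q
| OCX of Q & Q
| OCCX of Q & Q & Q.

Definition op_supp (Q : Type) (o : op Q) : seq Q :=
  match o with
  | OX q => [:: q] | OCX c t => [:: c; t] | OCCX a b t => [:: a; b; t]
  end.

Definition supp (Q : Type) (cs : seq (op Q)) : seq Q := flatten (map (@op_supp Q) cs).

Lemma supp_cat (Q : Type) (c1 c2 : seq (op Q)) : supp (c1 ++ c2) = supp c1 ++ supp c2.
Proof. by rewrite /supp map_cat flatten_cat. Qed.

Lemma supp_cons (Q : Type) (o : op Q) c : supp (o :: c) = op_supp o ++ supp c.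
Proof. by []. Qed.

Lemma mem_supp_rev (Q : eqType) (c : seq (op Q)) : supp (rev c) =i supp c.
Proof.
move=> q; elim: c => // o c IH; rewrite rev_cons -cats1 supp_cat mem_cat IH.
by rewrite !supp_cons !mem_cat orbF orbC.
Qed.

Lemma mem_supp_flatten (Q X : eqType) (c : X -> seq (op Q)) s q :
  reflect (exists2 x, x \in s & q \in supp (c x)) (q \in supp (flatten (map c s))).
Proof.
elim: s => [|y s IH] /=; first by constructor=> -[].
rewrite supp_cat mem_cat; apply: (iffP orP) => [[qy|/IH [x xs qx]]|[x]].
- by exists y; rewrite ?mem_head.
- by exists x; rewrite // inE xs orbT.
- by rewrite inE => /orP[/eqP ->|xs qx]; [left|right; apply/IH; exists x].
Qed.

(** A certificate in place of an explicit layering: each constructor survives reversal, injective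
    relabelling and compilation, so depth bounds transfer by induction. *)
Inductive dep (Q : eqType) : seq (op Q) -> nat -> Prop :=
| dep_nil : dep [::] 0
| dep_one o : dep [:: o] 1
| dep_cat c1 c2 D1 D2 : dep c1 D1 -> dep c2 D2 -> dep (c1 ++ c2) (D1 + D2)
| dep_par c1 c2 D : ~~ has (mem (supp c1)) (supp c2) -> dep c1 D -> dep c2 D ->
    dep (c1 ++ c2) D
| dep_weak c D D' : dep c D -> (D <= D')%N -> dep c D'.

Lemma dep_rev (Q : eqType) (c : seq (op Q)) D : dep c D -> dep (rev c) D.
Proof.
elim=> {c D} [|o|c1 c2 D1 D2 _ h1 _ h2|c1 c2 D dis _ h1 _ h2|c D D' _ h le].
- exact: dep_nil.
- exact: dep_one.
- by rewrite rev_cat addnC; exact: dep_cat.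
- rewrite rev_cat; apply: dep_par => //.
  apply: contra dis => /hasP[q]; rewrite /= !mem_supp_rev => q1 q2.
  by apply/hasP; exists q.
- exact: dep_weak h le.
Qed.

(** The function [own] names the only member of the family that may touch a given qubit; it stands
    for all the pairwise disjointness conditions at once. *)
Lemma dep_flatten (Q : eqType) (X : eqType) (c : X -> seq (op Q)) (own : Q -> option X)
    (s : seq X) D :
  uniq s -> (forall x, x \in s -> dep (c x) D) ->
  (forall x q, x \in s -> q \in supp (c x) -> own q = Some x) ->
  dep (flatten (map c s)) D.
Proof.
elim: s => [|x s IH] /=; first by move=> *; apply: dep_weak (dep_nil Q) _.
move=> /andP[xs us] h o; apply: dep_par.
- apply/hasPn => q /mem_supp_flatten [y ys qy].
  apply/negP => qx; move: (o x q (mem_head _ _) qx).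
  rewrite (o y q _ qy) ?inE ?ys ?orbT // => -[e].
  by move: xs; rewrite -e ys.
- by apply: h; rewrite mem_head.
- by apply: IH => // [y ys|y q ys]; [apply: h|apply: o]; rewrite inE ys orbT.
Qed.

Section Relabel.
Variables (Q Q' : eqType) (lab : Q -> Q').

Definition op_map (o : op Q) : op Q' :=
  match o with
  | OX q => OX (lab q) | OCX c t => OCX (lab c) (lab t)
  | OCCX a b t => OCCX (lab a) (lab b) (lab t)
  end.

Lemma op_supp_map o : op_supp (op_map o) = map lab (op_supp o).
Proof. by case: o. Qed.

Lemma supp_map c : supp (map op_map c) = map lab (supp c).
Proof.
elim: c => //= o c IH; rewrite /supp /= -/(supp _) op_supp_map map_cat.
by rewrite -IH.
Qed.

Lemma dep_map (c : seq (op Q)) D : injective lab -> dep c D -> dep (map op_map c) D.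
Proof.
move=> inj; elim=> {c D} [|o|c1 c2 D1 D2 _ h1 _ h2|c1 c2 D dis _ h1 _ h2|c D D' _ h le].
- exact: dep_nil.
- exact: dep_one.
- by rewrite map_cat; exact: dep_cat.
- rewrite map_cat; apply: dep_par => //; rewrite !supp_map has_map.
  apply: contra dis => /hasP[q q2]; rewrite /= mem_map // => q1.
  by apply/hasP; exists q.
- exact: dep_weak h le.
Qed.
End Relabel.

Definition op_ok (Q : eqType) (o : op Q) : Prop := uniq (op_supp o).

Definition ops_ok (Q : eqType) (c : seq (op Q)) := List.Forall (@op_ok Q) c.

Lemma ops_ok_cat (Q : eqType) (c1 c2 : seq (op Q)) :
  ops_ok (c1 ++ c2) <-> ops_ok c1 /\ ops_ok c2.
Proof. exact: List.Forall_app. Qed.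

Lemma ops_ok_rev (Q : eqType) (c : seq (op Q)) : ops_ok c -> ops_ok (rev c).
Proof.
elim: c => [|o c IH] //= ok; inversion ok; subst.
by rewrite rev_cons -cats1; apply/ops_ok_cat; split; [exact: IH|constructor].
Qed.

Lemma ops_ok_flatten (Q : eqType) (X : eqType) (c : X -> seq (op Q)) s :
  (forall x, x \in s -> ops_ok (c x)) -> ops_ok (flatten (map c s)).
Proof.
elim: s => [|x s IH] h /=; first by constructor.
apply/ops_ok_cat; split; first by apply: h; rewrite mem_head.
by apply: IH => y ys; apply: h; rewrite inE ys orbT.
Qed.

Lemma ops_ok_map (Q Q' : eqType) (lab : Q -> Q') c :
  injective lab -> ops_ok c -> ops_ok (map (op_map lab) c).
Proof.
move=> inj; elim: c => [|o c IH] ok /=; first by constructor.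
inversion ok; subst; constructor; last exact: IH.
by rewrite /op_ok op_supp_map map_inj_uniq.
Qed.

Section Exec.
Variable Q : finType.
Implicit Types (f g : {ffun Q -> bool}) (q : Q) (c : seq (op Q)).

Definition upd f q b : {ffun Q -> bool} := [ffun k => if k == q then b else f k].

Lemma updE f q b k : upd f q b k = if k == q then b else f k.
Proof. by rewrite ffunE. Qed.

Definition exec1 (o : op Q) f : {ffun Q -> bool} :=
  match o with
  | OX q => upd f q (~~ f q)
  | OCX c t => upd f t (f t (+) f c)
  | OCCX a b t => upd f t (f t (+) (f a && f b))
  end.

Definition exec c f := foldl (fun f o => exec1 o f) f c.

Lemma exec_cat c1 c2 f : exec (c1 ++ c2) f = exec c2 (exec c1 f).
Proof. exact: foldl_cat. Qed.

Lemma exec1_frame o f q : q \notin op_supp o -> exec1 o f q = f q.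
Proof.
case: o => [x|x t|x y t]; rewrite /= ?inE ?negb_or ?updE.
- by move/negbTE ->.
- by move=> /andP[_ /negbTE ->].
- by move=> /and3P[_ _ /negbTE ->].
Qed.

Lemma exec_frame c f q : q \notin supp c -> exec c f q = f q.
Proof.
elim: c f => //= o c IH f; rewrite supp_cons mem_cat negb_or => /andP[qo qc].
by rewrite IH // exec1_frame.
Qed.

Lemma exec1_local o (S : pred Q) f g : {subset op_supp o <= S} ->
  {in S, f =1 g} -> {in S, exec1 o f =1 exec1 o g}.
Proof.
move=> sub fg q qS.
have E x : x \in op_supp o -> f x = g x by move=> /sub; exact: fg.
case: o sub E => [x|x t|x y t] sub E /=; rewrite ?updE (fg q qS) //.
- by rewrite (E x) ?inE ?eqxx.
- by rewrite (E x) ?(E t) ?inE ?eqxx ?orbT.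
- by rewrite (E x) ?(E y) ?(E t) ?inE ?eqxx ?orbT.
Qed.

Lemma exec_local c (S : pred Q) f g : {subset supp c <= S} ->
  {in S, f =1 g} -> {in S, exec c f =1 exec c g}.
Proof.
elim: c f g => //= o c IH f g sub fg; apply: IH.
  by move=> q qc; apply: sub; rewrite supp_cons mem_cat qc orbT.
by apply: exec1_local => // q qc; apply: sub; rewrite supp_cons mem_cat qc.
Qed.

Lemma exec1K o f : op_ok o -> exec1 o (exec1 o f) = f.
Proof.
case: o => [x|x t|x y t] ; rewrite /op_ok /= ?inE ?andbT => u;
  apply/ffunP => q; rewrite !updE eqxx.
- by case: eqP => [->|//]; rewrite negbK.
- by rewrite (negbTE u); case: eqP => [->|//]; rewrite addbK.
- move: u; rewrite negb_or => /andP[/andP[_ /negbTE ->] /negbTE ->].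
  by case: eqP => [->|//]; rewrite addbK.
Qed.

Lemma exec_rev c f : ops_ok c -> exec (rev c) (exec c f) = f.
Proof.
elim: c f => //= o c IH f ok; inversion ok; subst.
by rewrite rev_cons -cats1 exec_cat IH //= exec1K.
Qed.

Lemma exec_flatten (X : eqType) (c : X -> seq (op Q)) (own : Q -> option X) s f x q :
  uniq s -> (forall x q, x \in s -> q \in supp (c x) -> own q = Some x) ->
  x \in s -> own q = Some x ->
  exec (flatten (map c s)) f q = exec (c x) f q.
Proof.
elim: s f => //= y s IH f /andP[ys us] o; rewrite inE exec_cat => xs oq.
have os : forall x q, x \in s -> q \in supp (c x) -> own q = Some x.
  by move=> z r zs; apply: o; rewrite inE zs orbT.
have [exy|nxy] := eqVneq x y.
  rewrite exec_frame ?exy //; apply/negP => /mem_supp_flatten [z zs qz].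
  by move: ys; move: (os z q zs qz); rewrite oq exy => -[->]; rewrite zs.
move: xs; rewrite (negbTE nxy) /= => xs.
rewrite IH //.
(* The head [y] may change other qubits, but the circuit of [x] reads and writes only qubits owned
   by [x]. *)
apply: (exec_local (S := [pred z | own z == Some x])); last by rewrite inE oq eqxx.
  by move=> r rx; rewrite inE (os x r xs rx).
move=> r; rewrite inE => /eqP ox; rewrite exec_frame //.
apply/negP => ry; move: (o y r (mem_head _ _) ry); rewrite ox => -[e].
by rewrite e eqxx in nxy.
Qed.

(** On its own support [rev P] sees exactly what [P] left, as [M] writes elsewhere; by locality it
    restores that support and leaves the result of [M] in place. *)
Lemma exec_uncompute P M f q : ops_ok P ->
  (forall g q', q' \in supp P -> exec M g q' = g q') ->
  exec (P ++ M ++ rev P) f q = if q \in supp P then f q else exec (P ++ M) f q.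
Proof.
move=> ok fr; rewrite catA exec_cat; case: ifP => qP; last first.
  by rewrite exec_frame // mem_supp_rev qP.
rewrite -[in RHS](exec_rev f ok) exec_cat.
apply: (exec_local (S := mem (supp P))) => //.
  by move=> r; rewrite mem_supp_rev.
by move=> r rP; exact: fr.
Qed.

End Exec.

Lemma exec_map (Q Q' : finType) (lab : Q -> Q') c (f : {ffun Q' -> bool}) q :
  injective lab ->
  exec (map (op_map lab) c) f (lab q) = exec c [ffun k => f (lab k)] q.
Proof.
move=> inj; elim: c f q => [|o c IH] f q /=; first by rewrite ffunE.
rewrite IH; congr (exec c _ q); apply/ffunP => k; rewrite ffunE.
by case: o => [x|x t|x y t] /=; rewrite ?updE !ffunE ?inj_eq.
Qed.
(** * Fan-out and gathering trees *)

(** Inner nodes carry no datum: a node is identified by the first leaf of its right subtree. This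
    matches nodes with the leaves other than the first, so no further qubits have to be named. *)
Inductive tree (T : Type) : Type := Leaf of T | Node of tree T & tree T.

Section Trees.
Variable T : Type.

Fixpoint thead (t : tree T) : T := match t with Leaf x => x | Node l _ => thead l end.
Fixpoint leaves (t : tree T) : seq T :=
  match t with Leaf x => [:: x] | Node l r => leaves l ++ leaves r end.
Fixpoint height (t : tree T) : nat :=
  match t with Leaf _ => 0 | Node l r => (maxn (height l) (height r)).+1 end.

Lemma leaves_cons t : leaves t = thead t :: behead (leaves t).
Proof. by elim: t => //= l -> r _. Qed.

Lemma behead_leaves_node l r :
  behead (leaves (Node l r)) = behead (leaves l) ++ leaves r.
Proof. by rewrite /= (leaves_cons l). Qed.

(** A full left subtree has [2 ^ h'] leaves and [x] is one of them, hence the predecessor in the cut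
    of [s]. *)
Fixpoint mktree (h : nat) (x : T) (s : seq T) : tree T :=
  if h is h'.+1 then
    match drop (2 ^ h').-1 s with
    | [::] => mktree h' x s
    | y :: s' => Node (mktree h' x (take (2 ^ h').-1 s)) (mktree h' y s')
    end
  else Leaf x.

Lemma leaves_mktree h x s : (size s < 2 ^ h)%N -> leaves (mktree h x s) = x :: s.
Proof.
elim: h x s => [|h IH] x s; first by case: s.
move=> sz /=; have p0 : (0 < 2 ^ h)%N by rewrite expn_gt0.
case E : (drop _ s) => [|y s'].
  apply: IH; move/(congr1 size): E; rewrite size_drop /=; lia.
have E2 := congr1 size E; rewrite size_drop /= in E2.
have := expnS 2 h => e2.
rewrite /= !IH; [|lia|].
  by rewrite cat_cons -E cat_take_drop.
by rewrite size_take; case: ifP; lia.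
Qed.

Lemma thead_mktree h x s : thead (mktree h x s) = x.
Proof. by elim: h x s => //= h IH x s; case: drop => [|y s'] /=; rewrite IH. Qed.

Lemma height_mktree h x s : (height (mktree h x s) <= h)%N.
Proof.
elim: h x s => //= h IH x s; case: drop => [|y s']; first exact: leqW.
by rewrite /= ltnS geq_max !IH.
Qed.

End Trees.

Lemma thead_leaves (T : eqType) (t : tree T) : thead t \in leaves t.
Proof. by rewrite leaves_cons mem_head. Qed.

Section Fan.
Variable Q : eqType.

Fixpoint fan (t : tree Q) : seq (op Q) :=
  match t with
  | Leaf _ => [::]
  | Node l r => OCX (thead l) (thead r) :: fan l ++ fan r
  end.

Lemma supp_fan t : {subset supp (fan t) <= leaves t}.
Proof.
elim: t => //= l IHl r IHr q; rewrite supp_cons supp_cat !mem_cat /= !inE.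
have hl : thead l \in leaves l by rewrite thead_leaves.
have hr : thead r \in leaves r by rewrite thead_leaves.
case/orP => [/orP[] /eqP ->|/orP[/IHl|/IHr] ->]; by rewrite ?hl ?hr ?orbT.
Qed.

Lemma fan_ok t : uniq (leaves t) -> ops_ok (fan t).
Proof.
elim: t => [x|l IHl r IHr] /=; first by constructor.
rewrite cat_uniq => /and3P[ul dis ur]; constructor; last first.
  by apply/ops_ok_cat; split; [exact: IHl|exact: IHr].
rewrite /op_ok /= andbT inE; apply: contra dis => /eqP e.
by apply/hasP; exists (thead r); rewrite ?thead_leaves //= -e thead_leaves.
Qed.

Lemma dep_fan t : uniq (leaves t) -> dep (fan t) (height t).
Proof.
elim: t => [x|l IHl r IHr] /=; first by move=> _; exact: dep_nil.
rewrite cat_uniq => /and3P[ul dis ur]; rewrite -cat1s -add1n.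
apply: dep_cat; first exact: dep_one.
apply: dep_par.
- apply: contra dis => /hasP[q /supp_fan qr /supp_fan ql].
  by apply/hasP; exists q.
- by apply: dep_weak (IHl ul) _; exact: leq_maxl.
- by apply: dep_weak (IHr ur) _; exact: leq_maxr.
Qed.

Lemma size_fan t : size (fan t) = (size (leaves t)).-1.
Proof.
elim: t => //= l IHl r IHr; rewrite !size_cat IHl IHr.
by rewrite (leaves_cons l) (leaves_cons r) /= addnS.
Qed.
End Fan.

Lemma exec_fan (Q : finType) (t : tree Q) (f : {ffun Q -> bool}) : uniq (leaves t) ->
  (forall q, q \in behead (leaves t) -> f q = false) ->
  forall q, q \in leaves t -> exec (fan t) f q = f (thead t).
Proof.
elim: t f => [x|l IHl r IHr] f.
  by move=> _ _ q; rewrite inE => /eqP ->.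
rewrite behead_leaves_node /= cat_uniq => /and3P[ul /hasPn dis ur] z q.
rewrite exec_cat mem_cat.
have zl q' : q' \in leaves l -> q' \notin leaves r.
  by move=> h; apply/negP => /dis; rewrite /= h.
have hr : thead r \in leaves r by rewrite thead_leaves.
have hl : thead l \in leaves l by rewrite thead_leaves.
have lr : thead l != thead r by apply/eqP => e; have := zl _ hl; rewrite e hr.
set f1 := upd f _ _.
have f1l q' : q' \in leaves l -> f1 q' = f q'.
  by move=> h; rewrite /f1 updE; case: eqP => // e; have := zl _ h; rewrite e hr.
have f1h : f1 (thead r) = f (thead l).
  by rewrite /f1 updE eqxx z ?mem_cat ?hr ?orbT.
case: (boolP (q \in leaves l)) => [ql _|_ /= qr].
  rewrite exec_frame; last by apply: contra (zl _ ql); exact: supp_fan.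
  rewrite IHl // ?f1l // => q' q'l; rewrite f1l; first by apply: z; rewrite mem_cat q'l.
  exact: mem_behead.
have g1 q' : q' \in leaves r -> exec (fan l) f1 q' = f1 q'.
  by move=> h; rewrite exec_frame //; apply/negP => /supp_fan; apply/negP; apply: dis.
rewrite IHr // ?g1 // => q' q'r; have q'r2 := mem_behead q'r.
rewrite g1 // /f1 updE ifN ?z ?mem_cat ?q'r2 ?orbT //.
by apply/eqP => e; move: ur; rewrite leaves_cons -e /= q'r.
Qed.

(** * Layers: parities and conjunctions along the edges of a bipartite graph *)

Section Layer.
Variables (X Y E : finType) (src : E -> X) (tgt : E -> Y) (act neg : pred E).
Variable conj : bool.
Variable h : nat.

(** Each target in [Y] is to be XORed with the conjunction or the parity, according to [conj], of
    the sources at its active edges, negated on the edges in [neg]. Encoding and comparison are both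
    instances, with the roles of sources and targets exchanged. *)
Definition lqubit : finType := ((X + Y) + (E + E))%type.
Notation sx x := (inl (inl x) : lqubit).
Notation sy y := (inl (inr y) : lqubit).
Notation sa e := (inr (inl e) : lqubit).
Notation sb e := (inr (inr e) : lqubit).

Definition bop (a b : bool) := if conj then a && b else a (+) b.
Definition bigb (s : seq E) (v : E -> bool) : bool :=
  if conj then \big[andb/true]_(e <- s) v e else \big[addb/false]_(e <- s) v e.

(* Edge [e] owns two qubits: [sa e] receives a copy of the source of [e], and [sb e] the
   value of the unique gathering node whose right subtree starts with [e]. *)
Definition comb (x y o : lqubit) : seq (op lqubit) :=
  if conj then [:: OCCX x y o] else [:: OCX x o; OCX y o].

Definition groot (t : tree E) : lqubit :=
  match t with Leaf e => sa e | Node _ r => sb (thead r) end.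

Fixpoint gather (t : tree E) : seq (op lqubit) :=
  match t with
  | Leaf _ => [::]
  | Node l r => (gather l ++ gather r) ++ comb (groot l) (groot r) (sb (thead r))
  end.

(** No right subtree starts with the first leaf, so its [sb] is left out; the root of the parent
    node can then use it without meeting the regions of its children. *)
Definition gregion (t : tree E) : pred lqubit := fun q =>
  match q with
  | inr (inl e) => e \in leaves t
  | inr (inr e) => e \in behead (leaves t)
  | _ => false
  end.

Lemma gregion_head_node l r : gregion (Node l r) (sb (thead r)).
Proof. by rewrite /gregion behead_leaves_node mem_cat thead_leaves orbT. Qed.

Lemma groot_region t : gregion t (groot t).
Proof.
case: t => [e|l r]; first by rewrite /= inE.
exact: gregion_head_node.
Qed.

Lemma gregion_node l r q :
  gregion l q || gregion r q -> gregion (Node l r) q.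
Proof.
case: q => [[x|y]|[e|e]] //; rewrite /gregion ?behead_leaves_node mem_cat //.
by case/orP => [->//|/mem_behead ->]; rewrite orbT.
Qed.

Lemma mem_comb x y o q : q \in supp (comb x y o) -> [|| q == x, q == y | q == o].
Proof.
by rewrite /comb; case: conj; rewrite /supp /= !in_cons in_nil;
  case: (q == x); case: (q == y); case: (q == o).
Qed.

Lemma supp_gather t q : q \in supp (gather t) -> gregion t q.
Proof.
elim: t => //= l IHl r IHr; rewrite !supp_cat !mem_cat.
case/orP => [/orP[/IHl|/IHr] e|/mem_comb /or3P[] /eqP ->].
- by apply: gregion_node; rewrite e.
- by apply: gregion_node; rewrite e orbT.
- by apply: gregion_node; rewrite groot_region.
- by apply: gregion_node; rewrite groot_region orbT.
- exact: gregion_head_node.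
Qed.

Lemma gregion_disj l r q : uniq (leaves (Node l r)) -> gregion l q -> ~~ gregion r q.
Proof.
rewrite /= cat_uniq => /and3P[_ /hasPn dis _].
have D e : e \in leaves l -> e \notin leaves r.
  by move=> h1; apply/negP => /dis; rewrite /= h1.
case: q => [[x|y]|[e|e]] //=; first exact: D.
by move=> /mem_behead /D; apply: contra => /mem_behead.
Qed.

Lemma gregion_head_r l r : uniq (leaves (Node l r)) ->
  ~~ gregion l (sb (thead r)) && ~~ gregion r (sb (thead r)).
Proof.
rewrite /= cat_uniq => /and3P[_ /hasPn dis ur]; apply/andP; split.
  apply/negP => /mem_behead; apply/negP; apply: dis.
  by rewrite thead_leaves.
by move: ur; rewrite leaves_cons /= => /andP[].
Qed.

Lemma gather_neq l r : uniq (leaves (Node l r)) ->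
  uniq [:: groot l; groot r; sb (thead r)].
Proof.
move=> u; have /andP[hl hr] := gregion_head_r u.
rewrite cons_uniq /= andbT !in_cons !in_nil !orbF negb_or; apply/andP; split; [apply/andP; split|].
- apply/eqP => e; have := gregion_disj u (groot_region l).
  by rewrite e groot_region.
- by apply/eqP => e; move: hl; rewrite -e groot_region.
- by apply/eqP => e; move: hr; rewrite -e groot_region.
Qed.

Lemma gather_ok t : uniq (leaves t) -> ops_ok (gather t).
Proof.
elim: t => [e|l IHl r IHr] u /=; first by constructor.
have := u; rewrite /= cat_uniq => /and3P[ul _ ur].
apply/ops_ok_cat; split; first by apply/ops_ok_cat; split; [exact: IHl|exact: IHr].
have v := gather_neq u; rewrite /comb; case: conj; first by constructor.
have [_ /eqP a /eqP b] := uniq3 v.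
by constructor; [|constructor]; rewrite // /op_ok /= inE ?a ?b.
Qed.

Lemma dep_gather t : uniq (leaves t) -> dep (gather t) (2 * height t)%N.
Proof.
elim: t => [e|l IHl r IHr] u /=; first exact: dep_nil.
have := u; rewrite /= cat_uniq => /and3P[ul _ ur].
rewrite mulnS addnC; apply: dep_cat; last first.
  rewrite /comb; case: conj; first exact: dep_weak (dep_one _) _.
  by rewrite -[2%N]/(1 + 1)%N -cat1s; apply: dep_cat; exact: dep_one.
apply: dep_par.
- apply/hasPn => q /supp_gather qr; apply/negP => /supp_gather ql.
  by have := gregion_disj u ql; rewrite qr.
- by apply: dep_weak (IHl ul) _; rewrite leq_mul2l leq_maxl.
- by apply: dep_weak (IHr ur) _; rewrite leq_mul2l leq_maxr.
Qed.

Lemma size_gather t : (size (gather t) <= 2 * (size (leaves t)).-1)%N.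
Proof.
elim: t => //= l IHl r IHr; rewrite !size_cat.
have : (size (comb (groot l) (groot r) (sb (thead r))) <= 2)%N.
  by rewrite /comb; case: conj.
move: IHl IHr; rewrite (leaves_cons l) (leaves_cons r) /=; lia.
Qed.

Fixpoint tval (t : tree E) (v : E -> bool) : bool :=
  match t with Leaf e => v e | Node l r => bop (tval l v) (tval r v) end.

Lemma tvalE t v : tval t v = bigb (leaves t) v.
Proof.
elim: t => [e|l IHl r IHr] /=; rewrite /bigb.
  by case: conj; rewrite big_seq1.
by rewrite IHl IHr /bigb /bop; case: conj; rewrite big_cat.
Qed.

Lemma eq_tval t v v' : {in leaves t, v =1 v'} -> tval t v = tval t v'.
Proof.
elim: t => [e|l IHl r IHr] /= h1; first by apply: h1; rewrite inE.
by rewrite IHl ?IHr // => e el; apply: h1; rewrite mem_cat el ?orbT.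
Qed.

Lemma exec_comb x y o (f : {ffun lqubit -> bool}) : uniq [:: x; y; o] ->
  exec (comb x y o) f o = f o (+) bop (f x) (f y).
Proof.
move=> /uniq3[_ /eqP xo /eqP yo]; rewrite /comb /bop; case: conj => /=.
  by rewrite updE eqxx.
by rewrite !updE eqxx (negbTE yo) addbA.
Qed.

Lemma exec_gather t (f : {ffun lqubit -> bool}) : uniq (leaves t) ->
  (forall e, e \in leaves t -> f (sb e) = false) ->
  exec (gather t) f (groot t) = tval t (fun e => f (sa e)).
Proof.
elim: t f => [e|l IHl r IHr] f u z //=.
have := u; rewrite /= cat_uniq => /and3P[ul /hasPn dis ur].
have /andP[hl hr] := gregion_head_r u.
have D q : gregion r q -> q \notin supp (gather l).
  by move=> qr; apply/negP => /supp_gather ql; have := gregion_disj u ql; rewrite qr.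
rewrite !exec_cat exec_comb; last exact: gather_neq.
rewrite exec_frame; last by apply: contra hr => /supp_gather.
rewrite exec_frame; last by apply: contra hl => /supp_gather.
rewrite z; last by rewrite /= mem_cat thead_leaves orbT.
rewrite addFb; congr (bop _ _).
  rewrite exec_frame.
    by rewrite IHl // => e el; rewrite z // /= mem_cat el.
  apply/negP => /supp_gather; apply/negP; exact: gregion_disj u (groot_region l).
have N b : b \in leaves r -> (sb b \notin supp (gather l)) && (sa b \notin supp (gather l)).
  move=> br; have nl : b \notin leaves l by exact: dis.
  apply/andP; split; apply/negP => /supp_gather /=.
    by move/mem_behead; apply/negP.
  exact/negP.
rewrite IHr //.
  by apply: eq_tval => e er; rewrite exec_frame //; have /andP[] := N e er.
move=> e er; rewrite exec_frame; last by have /andP[] := N e er.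
by rewrite z // /= mem_cat er orbT.
Qed.

Hypothesis hE : (#|E| < 2 ^ h)%N.

Definition edges_from x : seq E := [seq e <- enum E | act e && (src e == x)].
Definition edges_to y : seq E := [seq e <- enum E | act e && (tgt e == y)].

Definition fan_at x : seq (op lqubit) :=
  fan (mktree h (sx x) [seq sa e | e <- edges_from x]).
Definition neg_at e : seq (op lqubit) := if neg e then [:: OX (sa e)] else [::].
Definition gather_at y : seq (op lqubit) :=
  if edges_to y is e :: s then gather (mktree h e s) else [::].
(** A target without active edges is flipped in the conjunctive case, the empty conjunction being
    true. *)
Definition write_at y : seq (op lqubit) :=
  match edges_to y with
  | e :: s => [:: OCX (groot (mktree h e s)) (sy y)]
  | [::] => if conj then [:: OX (sy y)] else [::]
  end.

(** The preparation never touches a target and the write changes nothing else, which is the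
    condition for uncomputing. *)
Definition layer_prep : seq (op lqubit) :=
  flatten (map fan_at (enum X)) ++ flatten (map neg_at (enum E)) ++
  flatten (map gather_at (enum Y)).
Definition layer_write : seq (op lqubit) := flatten (map write_at (enum Y)).

(** Strictness matters: the source is a leaf of the fan-out tree besides its copies. *)
Lemma edges_from_small x : (size [seq sa e | e <- edges_from x] < 2 ^ h)%N.
Proof.
by rewrite size_map; apply: leq_ltn_trans hE; rewrite cardE size_filter count_size.
Qed.

Lemma edges_to_small y : (size (edges_to y) < 2 ^ h)%N.
Proof. by apply: leq_ltn_trans hE; rewrite cardE size_filter count_size. Qed.

Lemma leaves_from x :
  leaves (mktree h (sx x) [seq sa e | e <- edges_from x]) =
  sx x :: [seq sa e | e <- edges_from x].
Proof. exact/leaves_mktree/edges_from_small. Qed.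

Lemma leaves_to y e s : edges_to y = e :: s -> leaves (mktree h e s) = edges_to y.
Proof.
move=> ye; rewrite leaves_mktree ?ye //.
by have := edges_to_small y; rewrite ye; apply: ltn_trans.
Qed.

Lemma uniq_from x : uniq (sx x :: [seq sa e | e <- edges_from x]).
Proof.
rewrite cons_uniq; apply/andP; split; first by apply/mapP => -[].
by rewrite map_inj_uniq; [exact/filter_uniq/enum_uniq|move=> ? ? []].
Qed.

Lemma uniq_to y : uniq (edges_to y).
Proof. by rewrite filter_uniq ?enum_uniq. Qed.

Definition own_fan (q : lqubit) : option X :=
  match q with inl (inl x) => Some x | inr (inl e) => Some (src e) | _ => None end.
Definition own_neg (q : lqubit) : option E :=
  match q with inr (inl e) => Some e | _ => None end.
Definition own_to (q : lqubit) : option Y :=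
  match q with
  | inl (inr y) => Some y | inr (inl e) => Some (tgt e) | inr (inr e) => Some (tgt e)
  | _ => None end.

Lemma supp_fan_at x q : q \in supp (fan_at x) -> own_fan q = Some x.
Proof.
move/supp_fan; rewrite leaves_from inE => /orP[/eqP -> //|/mapP[e + ->]].
by rewrite mem_filter => /andP[/andP[_ /eqP <-]].
Qed.

Lemma supp_neg_at e q : q \in supp (neg_at e) -> q = sa e.
Proof. by rewrite /neg_at; case: ifP => // _; rewrite /supp /= inE => /eqP ->. Qed.

Lemma gregion_to y e s q : edges_to y = e :: s -> gregion (mktree h e s) q ->
  own_to q = Some y /\ match q with inr _ => True | _ => False end.
Proof.
move=> ye; case: q => [[x|y']|[e'|e']] //=.
  by rewrite (leaves_to ye) mem_filter => /andP[/andP[_ /eqP ->]].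
by move/mem_behead; rewrite (leaves_to ye) mem_filter => /andP[/andP[_ /eqP ->]].
Qed.

Lemma supp_gather_at y q : q \in supp (gather_at y) ->
  own_to q = Some y /\ match q with inr _ => True | _ => False end.
Proof.
by rewrite /gather_at; case ye : edges_to => [|e s] // /supp_gather; exact: gregion_to.
Qed.

Lemma supp_write_at y q : q \in supp (write_at y) -> own_to q = Some y.
Proof.
rewrite /write_at; case ye : edges_to => [|e s].
  by case: conj => //; rewrite /supp /= inE => /eqP ->.
rewrite /supp /= !inE => /orP[] /eqP -> //.
by have [] := gregion_to ye (groot_region _).
Qed.

Lemma supp_layer_prep q : q \in supp layer_prep ->
  match q with inl (inr _) => False | _ => True end.
Proof.
rewrite !supp_cat !mem_cat => /or3P[] /mem_supp_flatten[z _].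
- by move/supp_fan_at; case: q => [[]|].
- by move/supp_neg_at => ->.
- by move/supp_gather_at => []; case: q => [[]|].
Qed.

Lemma layer_prep_ok : ops_ok layer_prep.
Proof.
apply/ops_ok_cat; split; [|apply/ops_ok_cat; split]; apply: ops_ok_flatten => z _.
- by apply: fan_ok; rewrite leaves_from uniq_from.
- by rewrite /neg_at; case: ifP => _; do ? constructor.
- rewrite /gather_at; case ye : edges_to => [|e s]; first by constructor.
  by apply: gather_ok; rewrite (leaves_to ye) uniq_to.
Qed.

Lemma layer_write_ok : ops_ok layer_write.
Proof.
apply: ops_ok_flatten => y _; rewrite /write_at; case ye : edges_to => [|e s].
  by case: conj; do ? constructor.
constructor; last by constructor.
rewrite /op_ok /= andbT inE; apply/eqP => e1.
by have [_] := gregion_to ye (groot_region _); rewrite e1.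
Qed.

Lemma dep_layer_prep : dep layer_prep (h + (1 + 2 * h))%N.
Proof.
apply: dep_cat; [|apply: dep_cat].
- apply: (dep_flatten (own := own_fan)); first exact: enum_uniq.
    move=> x _; apply: dep_weak (height_mktree h (sx x) [seq sa e | e <- edges_from x]).
    by apply: dep_fan; rewrite leaves_from uniq_from.
  by move=> x q _; exact: supp_fan_at.
- apply: (dep_flatten (own := own_neg)); first exact: enum_uniq.
    move=> e _; rewrite /neg_at; case: ifP => _; first exact: dep_one.
    exact: dep_weak (dep_nil _) _.
  by move=> e q _ /supp_neg_at ->.
- apply: (dep_flatten (own := own_to)); first exact: enum_uniq.
    move=> y _; rewrite /gather_at; case ye : edges_to => [|e s].
      exact: dep_weak (dep_nil _) _.
    apply: dep_weak (dep_gather _) _; first by rewrite (leaves_to ye) uniq_to.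
    by rewrite leq_mul2l height_mktree.
  by move=> y q _ /supp_gather_at[].
Qed.

Lemma dep_layer_write : dep layer_write 1.
Proof.
apply: (dep_flatten (own := own_to)); first exact: enum_uniq.
  move=> y _; rewrite /write_at; case: edges_to => [|e s]; last exact: dep_one.
  by case: conj; [exact: dep_one|exact: dep_weak (dep_nil _) _].
by move=> y q _; exact: supp_write_at.
Qed.

(** Double counting: an edge lies in the fibre of one vertex only. This keeps the cost of all trees
    together linear in the number of edges. *)
Lemma sum_fibres (Z : finType) (p : E -> Z) :
  (\sum_(z <- enum Z) size [seq e <- enum E | act e && (p e == z)] <= #|E|)%N.
Proof.
rewrite big_enum /=.
under eq_bigr => z _ do rewrite size_filter -sum1_count big_enum_cond /= big_mkcond /=.
rewrite exchange_big /= -sum1_card; apply: leq_sum => e _.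
rewrite (bigD1 (p e)) //= big1 ?addn0; first by rewrite eqxx; case: act.
by move=> z ze; rewrite (eq_sym (p e)) (negbTE ze) andbF.
Qed.

Lemma size_flatten_map (Z T : Type) (c : Z -> seq T) s :
  size (flatten (map c s)) = (\sum_(z <- s) size (c z))%N.
Proof. by rewrite size_flatten /shape -map_comp sumnE big_map. Qed.

Lemma size_layer_prep : (size layer_prep <= 4 * #|E|)%N.
Proof.
rewrite !size_cat !size_flatten_map.
have H1 : (\sum_(x <- enum X) size (fan_at x) <= #|E|)%N.
  apply: leq_trans (sum_fibres src); apply: leq_sum => x _.
  by rewrite size_fan leaves_from /= size_map.
have H2 : (\sum_(e <- enum E) size (neg_at e) <= #|E|)%N.
  rewrite big_enum /= -sum1_card.
  by apply: leq_sum => e _; rewrite /neg_at; case: neg.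
have H3 : (\sum_(y <- enum Y) size (gather_at y) <= 2 * #|E|)%N.
  apply: leq_trans (_ : _ <= 2 * \sum_(y <- enum Y) size (edges_to y))%N _.
    rewrite big_distrr /=; apply: leq_sum => y _; rewrite /gather_at.
    case ye : edges_to => [|e s] //; apply: leq_trans (size_gather _) _.
    by rewrite (leaves_to ye) ye /= leq_mul2l leqW.
  by rewrite leq_mul2l sum_fibres.
by apply: leq_trans (leq_add H1 (leq_add H2 H3)) _; lia.
Qed.

Lemma size_layer_write : (size layer_write <= #|Y|)%N.
Proof.
rewrite size_flatten_map big_enum /= -sum1_card.
by apply: leq_sum => y _; rewrite /= /write_at; case: edges_to => //; case: conj.
Qed.

Lemma exec_layer (f : {ffun lqubit -> bool}) y :
  (forall e, f (sa e) = false) -> (forall e, f (sb e) = false) ->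
  exec (layer_prep ++ layer_write) f (sy y) =
  f (sy y) (+) bigb (edges_to y) (fun e => f (sx (src e)) (+) neg e).
Proof.
move=> za zb; rewrite /layer_prep !exec_cat.
set f1 := exec (flatten (map fan_at _)) f.
set f2 := exec (flatten (map neg_at _)) f1.
set f3 := exec (flatten (map gather_at _)) f2.
have f1a e : act e -> f1 (sa e) = f (sx (src e)).
  move=> ae; rewrite /f1 (@exec_flatten _ _ _ own_fan _ _ (src e)) ?enum_uniq ?mem_enum //.
    rewrite exec_fan ?leaves_from ?uniq_from //.
    - by rewrite thead_mktree.
    - by move=> q /= /mapP[e' _ ->].
    - by rewrite inE map_f // mem_filter ae eqxx mem_enum.
  by move=> x q _; exact: supp_fan_at.
have f1b e : f1 (sb e) = false.
  by rewrite /f1 exec_frame //; apply/negP => /mem_supp_flatten[x _ /supp_fan_at].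
have f2a e : act e -> f2 (sa e) = f (sx (src e)) (+) neg e.
  move=> ae; rewrite /f2 (@exec_flatten _ _ _ own_neg _ _ (e)) ?enum_uniq ?mem_enum //.
    by rewrite /neg_at; case: neg => /=; rewrite ?updE ?eqxx f1a // ?addbT ?addbF.
  by move=> x q _ /supp_neg_at ->.
have f2b e : f2 (sb e) = false.
  by rewrite /f2 exec_frame //; apply/negP => /mem_supp_flatten[x _ /supp_neg_at].
have f3y : f3 (sy y) = f (sy y).
  rewrite /f3 /f2 /f1 !exec_frame //; apply/negP => /mem_supp_flatten[x _].
  - by move/supp_fan_at.
  - by move/supp_neg_at.
  - by move/supp_gather_at => [].
rewrite (@exec_flatten _ _ _ own_to _ _ (y)) ?enum_uniq ?mem_enum //; last first.
  by move=> y' q _; exact: supp_write_at.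
rewrite /write_at; case ye : (edges_to y) => [|e s].
  by rewrite /bigb; case: conj; rewrite big_nil /= ?updE ?eqxx f3y ?addbT ?addbF.
rewrite /= updE eqxx f3y; congr (_ (+) _).
have lt := leaves_to ye; rewrite -ye -lt -tvalE.
have [ow _] := gregion_to ye (groot_region _).
rewrite /f3 (@exec_flatten _ _ _ own_to _ _ (y)) ?enum_uniq ?mem_enum //; last first.
  by move=> y' q _ /supp_gather_at[].
rewrite /gather_at ye exec_gather ?lt ?uniq_to //.
by apply: eq_tval => e'; rewrite lt mem_filter => /andP[/andP[ae _] _]; rewrite f2a.
Qed.

End Layer.
#[local] Arguments bigb : simpl never.

Lemma exec_flatten_id (Q : finType) (X : Type) (c : X -> seq (op Q)) s f q :
  (forall x g, exec (c x) g q = g q) -> exec (flatten (map c s)) f q = f q.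
Proof. by move=> h; elim: s f => //= x s IH f; rewrite exec_cat IH h. Qed.

Lemma exec_map_id (Q Q' : finType) (lab : Q -> Q') c (f : {ffun Q' -> bool}) q :
  injective lab -> (forall g q', lab q' = q -> exec c g q' = g q') ->
  exec (map (op_map lab) c) f q = f q.
Proof.
move=> inj h; case: (boolP (q \in codom lab)) => [/codomP[q' e]|nq].
  by rewrite e exec_map // h ?ffunE.
rewrite exec_frame // supp_map; apply: contra nq => /mapP[q' _ ->].
exact: codom_f.
Qed.

Lemma exec_write_frame (X Y E : finType) (tgt : E -> Y) act conj h
    (f : {ffun lqubit X Y E -> bool}) q :
  (forall y, q <> inl (inr y)) -> exec (layer_write X tgt act conj h) f q = f q.
Proof.
move=> nq; apply: exec_flatten_id => y g; rewrite /write_at.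
case: edges_to => [|e s]; last by rewrite /= updE; case: eqP => // /nq.
by case: conj => //=; rewrite updE; case: eqP => // /nq.
Qed.

(** * One layer with its clean-up *)

Section OneLayer.
Variables (X Y E Q : finType) (src : E -> X) (tgt : E -> Y) (act neg : pred E).
Variables (conj : bool) (h : nat) (lab : lqubit X Y E -> Q).
Hypotheses (labI : injective lab) (hE : (#|E| < 2 ^ h)%N).

Implicit Types f : {ffun Q -> bool}.

Let P := map (op_map lab) (layer_prep src tgt act neg conj h).
Let M := map (op_map lab) (layer_write X tgt act conj h).

Definition layer_circuit : seq (op Q) := P ++ M ++ rev P.

Lemma supp_map_prep q : q \in supp P -> forall y, q <> lab (inl (inr y)).
Proof.
by rewrite supp_map => /mapP[q' /(supp_layer_prep hE) + ->] y /labI e; rewrite e.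
Qed.

Lemma exec_map_write f q : (forall y, q <> lab (inl (inr y))) -> exec M f q = f q.
Proof.
move=> nq; apply: exec_map_id => // g q' e; apply: exec_write_frame => y e'.
by apply: (nq y); rewrite -e e'.
Qed.

Lemma exec_map_layer f y :
  (forall z, f (lab (inr z)) = false) ->
  exec (P ++ M) f (lab (inl (inr y))) = f (lab (inl (inr y))) (+)
    bigb conj (edges_to tgt act y) (fun e => f (lab (inl (inl (src e)))) (+) neg e).
Proof.
move=> z; rewrite -map_cat exec_map // exec_layer // ?ffunE //; try by move=> e; rewrite ffunE z.
by congr (_ (+) bigb _ _ _); apply: functional_extensionality => e; rewrite ffunE.
Qed.

Lemma exec_layer_circuit f q :
  (forall z, f (lab (inr z)) = false) ->
  (forall y, q <> lab (inl (inr y))) -> exec layer_circuit f q = f q.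
Proof.
move=> z nq; rewrite exec_uncompute.
- case: (boolP (q \in supp P)) => // qP.
  by rewrite exec_cat exec_map_write // exec_frame.
- exact/ops_ok_map/layer_prep_ok.
- by move=> g q' /supp_map_prep; exact: exec_map_write.
Qed.

Lemma exec_layer_circuit_tgt f y :
  (forall z, f (lab (inr z)) = false) ->
  exec layer_circuit f (lab (inl (inr y))) = f (lab (inl (inr y))) (+)
    bigb conj (edges_to tgt act y) (fun e => f (lab (inl (inl (src e)))) (+) neg e).
Proof.
move=> z; rewrite exec_uncompute.
- by case: ifP => [/supp_map_prep /(_ y)//|_]; exact: exec_map_layer.
- exact/ops_ok_map/layer_prep_ok.
- by move=> g q' /supp_map_prep; exact: exec_map_write.
Qed.

Lemma layer_circuit_ok : ops_ok layer_circuit.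
Proof.
apply/ops_ok_cat; split; first exact/ops_ok_map/layer_prep_ok.
apply/ops_ok_cat; split; first exact/ops_ok_map/layer_write_ok.
exact/ops_ok_rev/ops_ok_map/layer_prep_ok.
Qed.

Lemma dep_layer_circuit : dep layer_circuit (6 * h + 3)%N.
Proof.
apply: (dep_weak (D := (h + (1 + 2 * h) + (1 + (h + (1 + 2 * h))))%N)); last by lia.
apply: dep_cat; first exact/dep_map/dep_layer_prep.
apply: dep_cat; first exact/dep_map/dep_layer_write.
exact/dep_rev/dep_map/dep_layer_prep.
Qed.

Lemma size_layer_circuit : (size layer_circuit <= 8 * #|E| + #|Y|)%N.
Proof.
rewrite /layer_circuit /P /M !size_cat size_rev !size_map.
have := size_layer_prep src tgt act neg conj hE.
have := size_layer_write X tgt act conj h.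
set p := size (layer_prep _ _ _ _ _ _); set w := size (layer_write _ _ _ _ _).
move: p w => p w; lia.
Qed.

End OneLayer.

(** * Two layers sharing their middle nodes *)

Section TwoLayers.
Variables (X Y Z E1 E2 Q : finType).
Variables (src1 : E1 -> X) (tgt1 : E1 -> Y) (act1 neg1 : pred E1) (conj1 : bool).
Variables (src2 : E2 -> Y) (tgt2 : E2 -> Z) (act2 neg2 : pred E2) (conj2 : bool).
Variables (h : nat) (lab1 : lqubit X Y E1 -> Q) (lab2 : lqubit Y Z E2 -> Q).
Hypotheses (lab1I : injective lab1) (lab2I : injective lab2).
Hypothesis mid : forall y, lab1 (inl (inr y)) = lab2 (inl (inl y)).
Hypothesis dis : forall q1 q2, lab1 q1 = lab2 q2 -> exists y, q2 = inl (inl y).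
Hypotheses (hE1 : (#|E1| < 2 ^ h)%N) (hE2 : (#|E2| < 2 ^ h)%N).

Implicit Types f : {ffun Q -> bool}.

Let P1 := map (op_map lab1) (layer_prep src1 tgt1 act1 neg1 conj1 h).
Let M1 := map (op_map lab1) (layer_write X tgt1 act1 conj1 h).
Let P2 := map (op_map lab2) (layer_prep src2 tgt2 act2 neg2 conj2 h).
Let M2 := map (op_map lab2) (layer_write Y tgt2 act2 conj2 h).
Let P := (P1 ++ M1) ++ P2.

(** The middle nodes and the ancillas of the first layer stay dirty while the second layer reads
    them; the single [rev P] clears both layers, so the first write is also undone. *)
Definition two_layer_circuit : seq (op Q) := P ++ M2 ++ rev P.

Lemma two_prep_ok : ops_ok P.
Proof.
apply/ops_ok_cat; split; last exact/ops_ok_map/layer_prep_ok.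
apply/ops_ok_cat; split; first exact/ops_ok_map/layer_prep_ok.
exact/ops_ok_map/layer_write_ok.
Qed.

Lemma supp_first q : q \in supp (P1 ++ M1) -> exists q1, q = lab1 q1.
Proof. by rewrite -map_cat supp_map => /mapP[q1 _ ->]; exists q1. Qed.

Lemma supp_two_prep q : q \in supp P -> forall z, q <> lab2 (inl (inr z)).
Proof.
rewrite supp_cat mem_cat => /orP[/supp_first[q1 ->] z /dis[y]|] //.
exact: (supp_map_prep lab2I hE2).
Qed.

Lemma exec_two_layer_circuit f q :
  (forall z, q <> lab2 (inl (inr z))) -> exec two_layer_circuit f q = f q.
Proof.
move=> nq; rewrite exec_uncompute.
- case: (boolP (q \in supp P)) => // qP.
  by rewrite exec_cat exec_map_write // exec_frame.
- exact: two_prep_ok.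
- by move=> g q' /supp_two_prep; exact: exec_map_write.
Qed.

Lemma exec_two_layer_circuit_tgt f z :
  (forall e, f (lab1 (inr e)) = false) -> (forall e, f (lab2 (inr e)) = false) ->
  (forall y, f (lab1 (inl (inr y))) = false) ->
  exec two_layer_circuit f (lab2 (inl (inr z))) = f (lab2 (inl (inr z))) (+)
    bigb conj2 (edges_to tgt2 act2 z) (fun e2 =>
      bigb conj1 (edges_to tgt1 act1 (src2 e2)) (fun e1 =>
        f (lab1 (inl (inl (src1 e1)))) (+) neg1 e1) (+) neg2 e2).
Proof.
move=> z1 z2 zm; rewrite exec_uncompute.
- case: ifP => [/supp_two_prep /(_ z)//|_].
  rewrite /P -catA exec_cat exec_map_layer //; last first.
    by move=> e; rewrite exec_frame ?z2 //; apply/negP => /supp_first[q1 /esym/dis[]].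
  congr (_ (+) _).
    by rewrite exec_frame //; apply/negP => /supp_first[q1 /esym/dis[]].
  congr (bigb _ _ _); apply: functional_extensionality => e2; congr (_ (+) _).
  by rewrite -mid exec_map_layer // zm.
- exact: two_prep_ok.
- by move=> g q' /supp_two_prep; exact: exec_map_write.
Qed.

Lemma two_layer_circuit_ok : ops_ok two_layer_circuit.
Proof.
apply/ops_ok_cat; split; first exact: two_prep_ok.
apply/ops_ok_cat; split; first exact/ops_ok_map/layer_write_ok.
exact/ops_ok_rev/two_prep_ok.
Qed.

Lemma dep_two_layer_circuit : dep two_layer_circuit (12 * h + 7)%N.
Proof.
have dP : dep P ((h + (1 + 2 * h) + 1) + (h + (1 + 2 * h)))%N.
  apply: dep_cat; last exact/dep_map/dep_layer_prep.
  apply: dep_cat; first exact/dep_map/dep_layer_prep.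
  exact/dep_map/dep_layer_write.
apply: (dep_weak (D := (((h + (1 + 2 * h) + 1) + (h + (1 + 2 * h))) +
  (1 + ((h + (1 + 2 * h) + 1) + (h + (1 + 2 * h)))))%N)); last by lia.
apply: dep_cat => //; apply: dep_cat; first exact/dep_map/dep_layer_write.
exact: dep_rev.
Qed.

Lemma size_two_layer_circuit :
  (size two_layer_circuit <= 8 * #|E1| + 2 * #|Y| + 8 * #|E2| + #|Z|)%N.
Proof.
rewrite /two_layer_circuit /P /P1 /P2 /M1 /M2 !size_cat size_rev !size_cat !size_map.
have := size_layer_prep src1 tgt1 act1 neg1 conj1 hE1.
have := size_layer_prep src2 tgt2 act2 neg2 conj2 hE2.
have := size_layer_write X tgt1 act1 conj1 h.
have := size_layer_write Y tgt2 act2 conj2 h.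
set p1 := size (layer_prep src1 _ _ _ _ _); set p2 := size (layer_prep src2 _ _ _ _ _).
set w1 := size (layer_write _ tgt1 _ _ _); set w2 := size (layer_write _ tgt2 _ _ _).
move: p1 p2 w1 w2 => p1 p2 w1 w2; lia.
Qed.
End TwoLayers.

Lemma bigb_true (E : finType) (s : seq E) v : bigb true s v = all v s.
Proof. by rewrite /bigb big_all. Qed.

(** A parity with at most one true term is a selection: this is how a one-hot index picks the bits
    of its item. *)
Lemma bigb_pred1 (E : finType) (s : seq E) (v : E -> bool) e0 : uniq s ->
  {in s, forall e, v e = (e == e0)} -> bigb false s v = (e0 \in s).
Proof.
rewrite /bigb; elim: s => [|e s IH] /=; first by rewrite big_nil.
move=> /andP[es us] vE; rewrite big_cons inE vE ?mem_head // IH //.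
  by move: es; have [->|//] := eqVneq e e0 => es; rewrite (negbTE es).
by move=> x xs; apply: vE; rewrite inE xs orbT.
Qed.

(** * Loading a batch of items *)

Section Loading.
Variables (V I : finType) (q : I -> {ffun V -> bool}).

(** All of [Rest] reads 0, so an equation between two such states also asserts that the ancillas
    have been cleaned. *)
Definition basis_st (Rest : finType) (r : {ffun V -> bool}) (e : {ffun I -> bool}) :
    {ffun V + (I + Rest) -> bool} :=
  [ffun x => match x with inl v => r v | inr (inl i) => e i | _ => false end].

Definition hot (o : option I) : {ffun I -> bool} := [ffun i => o == Some i].

(* The classical part of a batch: a one-hot index is traded for the item it designates. *)
Definition loads (Rest : finType) (c : seq (op (V + (I + Rest)))) : Prop :=
  (forall r, (forall i, r <> q i) ->
     exec c (basis_st Rest r (hot None)) = basis_st Rest r (hot None)) /\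
  (forall i, exec c (basis_st Rest [ffun=> false] (hot (Some i))) =
     basis_st Rest (q i) (hot None)).

(** Once the item [q i] stands in an empty register, injectivity makes [i] the only index whose
    comparison succeeds, so XORing the outcomes clears exactly the hot bit. With no hot index and a
    register that is not an item, both halves act trivially. *)
Lemma loads_cat (Rest : finType) (enc dec : seq (op (V + (I + Rest)))) :
  injective q ->
  (forall r o, exec enc (basis_st Rest r (hot o)) =
     basis_st Rest [ffun v => r v (+) oapp (fun i => q i v) false o] (hot o)) ->
  (forall r e, exec dec (basis_st Rest r e) =
     basis_st Rest r [ffun i => e i (+) (r == q i)]) ->
  loads (enc ++ dec).
Proof.
move=> qI encE decE; split=> [r nr|i]; rewrite exec_cat encE decE.
  apply/ffunP => -[v|[i|z]]; rewrite !ffunE //= ?addbF //.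
  set r' := [ffun v => _]; have -> : r' = r by apply/ffunP => v; rewrite ffunE addbF.
  by case: eqP => // /nr.
apply/ffunP => -[v|[j|z]]; rewrite !ffunE //=.
set r' := [ffun v => _]; have -> : r' = q i by apply/ffunP => v; rewrite !ffunE.
rewrite (inj_eq qI) (inj_eq (can_inj (fun x => erefl : odflt i (Some x) = x))).
by rewrite addbb.
Qed.

(** * Loading bit by bit *)

Section OneLevel.
Variable h : nat.
Hypotheses (qI : injective q) (hE : (#|{: V * I}| < 2 ^ h)%N).

Definition rest1 : finType := ((V * I) + (V * I))%type.
Notation Q := (V + (I + rest1))%type.

Definition enc1_lab (x : lqubit I V (V * I)%type) : Q :=
  match x with inl (inl i) => inr (inl i) | inl (inr v) => inl v | inr z => inr (inr z) end.
Definition dec1_lab (x : lqubit V I (V * I)%type) : Q :=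
  match x with inl (inl v) => inl v | inl (inr i) => inr (inl i) | inr z => inr (inr z) end.

Definition enc1 : seq (op Q) :=
  layer_circuit snd fst (fun e => q e.2 e.1) pred0 false h enc1_lab.
(** Negating the edges where the item has a 0 turns each edge into a test that two bits agree, and
    the conjunction into a test of equality. *)
Definition dec1 : seq (op Q) :=
  layer_circuit fst snd predT (fun e => ~~ q e.2 e.1) true h dec1_lab.

Lemma enc1_labI : injective enc1_lab.
Proof. by move=> [[?|?]|?] [[?|?]|?] //= [->]. Qed.

Lemma dec1_labI : injective dec1_lab.
Proof. by move=> [[?|?]|?] [[?|?]|?] //= [->]. Qed.

Lemma exec_enc1 r o : exec enc1 (basis_st rest1 r (hot o)) =
  basis_st rest1 [ffun v => r v (+) oapp (fun i => q i v) false o] (hot o).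
Proof.
have z x : basis_st rest1 r (hot o) (enc1_lab (inr x)) = false by rewrite ffunE.
apply/ffunP => -[v|x]; last first.
  by rewrite (exec_layer_circuit _ _ _ _ _ enc1_labI) // !ffunE.
rewrite (exec_layer_circuit_tgt _ _ _ _ _ enc1_labI hE v z) !ffunE; congr (_ (+) _).
case: o {z} => [i|] /=.
  rewrite (bigb_pred1 (e0 := (v, i))).
  - by rewrite mem_filter mem_enum /= eqxx !andbT.
  - exact: uniq_to.
  - move=> [v' i']; rewrite mem_filter => /andP[/andP[_ /eqP /= ->] _].
    by rewrite !ffunE addbF xpair_eqE eqxx /= (inj_eq Some_inj) eq_sym.
by rewrite /bigb big1_seq // => e _; rewrite !ffunE.
Qed.

Lemma exec_dec1 r e : exec dec1 (basis_st rest1 r e) =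
  basis_st rest1 r [ffun i => e i (+) (r == q i)].
Proof.
have z x : basis_st rest1 r e (dec1_lab (inr x)) = false by rewrite ffunE.
apply/ffunP => -[v|[i|x]].
- by rewrite (exec_layer_circuit _ _ _ _ _ dec1_labI) // !ffunE.
- rewrite (exec_layer_circuit_tgt _ _ _ _ _ dec1_labI hE i z) !ffunE; congr (_ (+) _).
  rewrite bigb_true; apply/allP/eqP => [al|-> [v i']].
    apply/ffunP => v; have := al (v, i); rewrite mem_filter mem_enum /= eqxx !ffunE.
    by move=> /(_ isT); case: (r v); case: (q i v).
  by rewrite mem_filter => /andP[/andP[_ /eqP /= ->] _]; rewrite !ffunE addbN addbb.
- by rewrite (exec_layer_circuit _ _ _ _ _ dec1_labI) // !ffunE.
Qed.

Lemma loads1 : loads (enc1 ++ dec1).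
Proof. exact: (loads_cat qI exec_enc1 exec_dec1). Qed.

Lemma load1_ok : ops_ok (enc1 ++ dec1).
Proof.
by apply/ops_ok_cat; split; apply: layer_circuit_ok => //;
  [exact: enc1_labI|exact: dec1_labI].
Qed.

Lemma dep_load1 : dep (enc1 ++ dec1) (12 * h + 6)%N.
Proof.
rewrite (_ : (12 * h + 6 = (6 * h + 3) + (6 * h + 3))%N); last by lia.
by apply: dep_cat; apply: dep_layer_circuit => //;
  [exact: enc1_labI|exact: dec1_labI].
Qed.

Lemma size_load1 : (size (enc1 ++ dec1) <= 16 * #|{: V * I}| + #|V| + #|I|)%N.
Proof.
rewrite size_cat.
have e := size_layer_circuit snd fst (fun e => q e.2 e.1) pred0 false enc1_lab hE.
have d := size_layer_circuit fst snd predT (fun e => ~~ q e.2 e.1) true dec1_lab hE.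
apply: leq_trans (leq_add e d) _.
set a := #|{: V * I}|; set b := #|V|; set c := #|I|; move: a b c => a b c; lia.
Qed.
End OneLevel.

(** * Loading through the words of the blocks *)

Section TwoLevel.
Variables (B S : finType) (blk : V -> B) (pos : V -> S) (h : nat).
Hypothesis bpI : injective (fun v => (blk v, pos v)).

Definition word_t : finType := {ffun S -> bool}.
Definition node_t : finType := (B * word_t)%type.
Definition edge1_t : finType := (B * I)%type.
Definition edge2_t : finType := (V * word_t)%type.

(** The last block may be incomplete, so [(blk, pos)] is only injective, and positions without a bit
    read as false. *)
Definition word (b : B) (r : {ffun V -> bool}) : word_t :=
  [ffun l => [exists v, [&& blk v == b, pos v == l & r v]]].

Lemma wordE r v : word (blk v) r (pos v) = r v.
Proof.
rewrite ffunE; apply/existsP/idP => [[v' /and3P[/eqP b /eqP p]]|rv].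
  by have -> : v' = v by apply: bpI; rewrite b p.
by exists v; rewrite !eqxx.
Qed.

Hypotheses (qI : injective q).
Hypotheses (hE1 : (#|edge1_t| < 2 ^ h)%N) (hE2 : (#|edge2_t| < 2 ^ h)%N).

Definition rest2 : finType :=
  (node_t + ((edge1_t + edge1_t) + (edge2_t + edge2_t)))%type.
Notation Q := (V + (I + rest2))%type.

Definition enc2_lab1 (x : lqubit I node_t edge1_t) : Q :=
  match x with
  | inl (inl i) => inr (inl i) | inl (inr y) => inr (inr (inl y))
  | inr z => inr (inr (inr (inl z))) end.
Definition enc2_lab2 (x : lqubit node_t V edge2_t) : Q :=
  match x with
  | inl (inl y) => inr (inr (inl y)) | inl (inr v) => inl v
  | inr z => inr (inr (inr (inr z))) end.
Definition dec2_lab1 (x : lqubit V node_t edge2_t) : Q :=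
  match x with
  | inl (inl v) => inl v | inl (inr y) => inr (inr (inl y))
  | inr z => inr (inr (inr (inr z))) end.
Definition dec2_lab2 (x : lqubit node_t I edge1_t) : Q :=
  match x with
  | inl (inl y) => inr (inr (inl y)) | inl (inr i) => inr (inl i)
  | inr z => inr (inr (inr (inl z))) end.

Lemma enc2_lab1I : injective enc2_lab1.
Proof. by move=> [[?|?]|?] [[?|?]|?] //= [->]. Qed.
Lemma enc2_lab2I : injective enc2_lab2.
Proof. by move=> [[?|?]|?] [[?|?]|?] //= [->]. Qed.
Lemma dec2_lab1I : injective dec2_lab1.
Proof. by move=> [[?|?]|?] [[?|?]|?] //= [->]. Qed.
Lemma dec2_lab2I : injective dec2_lab2.
Proof. by move=> [[?|?]|?] [[?|?]|?] //= [->]. Qed.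

Lemma enc2_dis q1 q2 : enc2_lab1 q1 = enc2_lab2 q2 -> exists y, q2 = inl (inl y).
Proof. by case: q1 q2 => [[?|?]|?] [[y|?]|?] //= _; exists y. Qed.
Lemma dec2_dis q1 q2 : dec2_lab1 q1 = dec2_lab2 q2 -> exists y, q2 = inl (inl y).
Proof. by case: q1 q2 => [[?|?]|?] [[y|?]|?] //= _; exists y. Qed.

Definition enc2 : seq (op Q) :=
  two_layer_circuit snd (fun e : edge1_t => (e.1, word e.1 (q e.2)) : node_t) predT pred0 false
    (fun e : edge2_t => (blk e.1, e.2) : node_t) fst (fun e => e.2 (pos e.1)) pred0 false
    h enc2_lab1 enc2_lab2.
(** The encoding graph is traversed backwards: a node tells whether its block reads its word, and an
    item is recognised by the conjunction over the blocks. In an incomplete block several words can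
    pass the test together; this is harmless, since an item consults only the node of its own
    word. *)
Definition dec2 : seq (op Q) :=
  two_layer_circuit fst (fun e : edge2_t => (blk e.1, e.2) : node_t) predT
    (fun e => ~~ e.2 (pos e.1)) true
    (fun e : edge1_t => (e.1, word e.1 (q e.2)) : node_t) snd predT pred0 true
    h dec2_lab1 dec2_lab2.

Lemma exec_enc2 r o : exec enc2 (basis_st rest2 r (hot o)) =
  basis_st rest2 [ffun v => r v (+) oapp (fun i => q i v) false o] (hot o).
Proof.
apply/ffunP => -[v|x]; last first.
  by rewrite (exec_two_layer_circuit _ _ _ _ _ _ _ _ _ _ enc2_lab1I enc2_lab2I enc2_dis hE1 hE2) ?ffunE.
rewrite (exec_two_layer_circuit_tgt _ _ _ _ _ _ _ _ _ _ enc2_lab1I enc2_lab2I (fun=> erefl) enc2_dis hE1 hE2 v) //;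
  try by move=> ?; rewrite ffunE.
rewrite !ffunE; congr (_ (+) _); case: o => [i|] /=; last first.
  rewrite /bigb big1_seq // => e2 _; rewrite big1_seq // => e1 _.
  by rewrite ffunE /= ffunE.
(* In the block of [v] only the word of [q i] is excited, and its edge to [v] is active just when
   [q i] has a 1 there. *)
rewrite (bigb_pred1 (e0 := (v, word (blk v) (q i)))).
- by rewrite mem_filter mem_enum /= eqxx wordE !andbT.
- exact: uniq_to.
move=> [v' w]; rewrite mem_filter => /andP[/andP[_ /eqP /= ->] _].
rewrite addbF (bigb_pred1 (e0 := (blk v, i))).
- by rewrite mem_filter mem_enum /= xpair_eqE eqxx /= andbT eq_sym xpair_eqE eqxx.
- exact: uniq_to.
move=> [b i']; rewrite mem_filter => /andP[/= /eqP [-> _] _].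
by rewrite ffunE /= ffunE addbF xpair_eqE eqxx /= (inj_eq Some_inj) eq_sym.
Qed.

Lemma exec_dec2 r e : exec dec2 (basis_st rest2 r e) =
  basis_st rest2 r [ffun i => e i (+) (r == q i)].
Proof.
have F x : (forall i, x <> inr (inl i)) ->
    exec dec2 (basis_st rest2 r e) x = basis_st rest2 r e x.
  by move=> nx; rewrite (exec_two_layer_circuit _ _ _ _ _ _ _ _ _ _ dec2_lab1I dec2_lab2I dec2_dis hE2 hE1).
apply/ffunP => -[v|[i|x]]; first by rewrite F // !ffunE.
  2: by rewrite F // !ffunE.
rewrite (exec_two_layer_circuit_tgt _ _ _ _ _ _ _ _ _ _ dec2_lab1I dec2_lab2I (fun=> erefl) dec2_dis hE2 hE1 i) //;
  try by move=> ?; rewrite ffunE.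
rewrite !ffunE; congr (_ (+) _).
rewrite bigb_true; apply/allP/eqP => [al|-> [b i']].
  apply/ffunP => v; have := al (blk v, i); rewrite mem_filter mem_enum /= eqxx addbF.
  rewrite bigb_true => /(_ isT) /allP /(_ (v, word (blk v) (q i))).
  rewrite mem_filter mem_enum /= eqxx wordE ffunE /= => /(_ isT).
  by case: (r v); case: (q i v).
rewrite mem_filter => /andP[/andP[_ /eqP /= ->] _]; rewrite addbF bigb_true.
apply/allP => -[v w]; rewrite mem_filter => /andP[/= /eqP [<- ->] _].
by rewrite wordE ffunE /= addbN addbb.
Qed.

Lemma loads2 : loads (enc2 ++ dec2).
Proof. exact: (loads_cat qI exec_enc2 exec_dec2). Qed.

Lemma load2_ok : ops_ok (enc2 ++ dec2).
Proof.
apply/ops_ok_cat; split; apply: two_layer_circuit_ok => //.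
- exact: enc2_lab1I. 
- exact: enc2_lab2I.
- exact: dec2_lab1I.
- exact: dec2_lab2I.
Qed.

Lemma dep_load2 : dep (enc2 ++ dec2) (24 * h + 14)%N.
Proof.
rewrite (_ : (24 * h + 14 = (12 * h + 7) + (12 * h + 7))%N); last by lia.
apply: dep_cat; apply: dep_two_layer_circuit => //.
- exact: enc2_lab1I.
- exact: enc2_lab2I.
- exact: dec2_lab1I.
- exact: dec2_lab2I.
Qed.

Lemma size_load2 : (size (enc2 ++ dec2) <=
  16 * #|edge1_t| + 4 * #|node_t| + 16 * #|edge2_t| + #|V| + #|I|)%N.
Proof.
rewrite size_cat.
have e := @size_two_layer_circuit _ _ _ _ _ _ snd (fun e : edge1_t => (e.1, word e.1 (q e.2)) : node_t) predT pred0 false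
    (fun e : edge2_t => (blk e.1, e.2) : node_t) fst (fun e => e.2 (pos e.1)) pred0 false h enc2_lab1 enc2_lab2 hE1 hE2.
have d := @size_two_layer_circuit _ _ _ _ _ _ fst (fun e : edge2_t => (blk e.1, e.2) : node_t) predT
    (fun e => ~~ e.2 (pos e.1)) true
    (fun e : edge1_t => (e.1, word e.1 (q e.2)) : node_t) snd predT pred0 true h dec2_lab1 dec2_lab2 hE2 hE1.
apply: leq_trans (leq_add e d) _.
set e1 := #|edge1_t|; set e2 := #|edge2_t|; set nd := #|node_t|; set v := #|V|; set k := #|I|.
move: e1 e2 nd v k => e1 e2 nd v k; lia.
Qed.
End TwoLevel.
End Loading.
#[local] Arguments apply_gate : simpl never.
#[local] Arguments ccx : simpl never.
#[local] Arguments amp_split : simpl never.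
#[local] Arguments run : simpl never.

Lemma circuit_ok_cat N (c1 c2 : circuit N) :
  circuit_ok (c1 ++ c2) <-> circuit_ok c1 /\ circuit_ok c2.
Proof. exact: List.Forall_app. Qed.

(** * Compilation into one-qubit gates and CNOTs *)

Section Compile.
Variables (Q : finType) (N : nat) (iota : Q -> 'I_N).
Hypothesis iotaI : injective iota.

Definition emb (f : {ffun Q -> bool}) : bits N :=
  [ffun j => [exists q, (iota q == j) && f q]].

Lemma embE f q : emb f (iota q) = f q.
Proof.
rewrite ffunE; apply/existsP/idP => [[q' /andP[/eqP/iotaI -> //]]|fq].
by exists q; rewrite eqxx.
Qed.

Lemma emb_upd f q b : emb (upd f q b) = setbit (emb f) (iota q) b.
Proof.
apply/ffunP => j; rewrite setbitE.
case: (boolP (j \in codom iota)) => [/codomP[q' ->]|nj].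
  by rewrite !embE updE inj_eq.
have z g : emb g j = false.
  rewrite ffunE; apply/existsP => -[q' /andP[/eqP e _]].
  by move: nj; rewrite -e codom_f.
by rewrite !z; case: eqP => // e; move: nj; rewrite e codom_f.
Qed.

Definition compile_op (o : op Q) : circuit N :=
  match o with
  | OX q => [:: G1 (iota q) uX]
  | OCX c t => [:: CNOT (iota c) (iota t)]
  | OCCX a b t => ccx (iota a) (iota b) (iota t)
  end.

Definition compile (c : seq (op Q)) : circuit N := flatten (map compile_op c).

Lemma run_compile_op o f : op_ok o ->
  run (compile_op o) (ket (emb f)) = ket (emb (exec1 o f)).
Proof.
case: o => [q|c t|a b t]; rewrite /op_ok /= => u.
- by rewrite [LHS]apply_X_ket emb_upd embE.
- rewrite [LHS]apply_CNOT_ket ?emb_upd ?embE // => /iotaI e.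
  by move: u; rewrite e mem_head.
- rewrite run_ccx ?emb_upd ?embE //.
  by rewrite -[[:: _; _; _]]/(map iota [:: a; b; t]) map_inj_uniq.
Qed.

Lemma run_compile c f : ops_ok c ->
  run (compile c) (ket (emb f)) = ket (emb (exec c f)).
Proof.
elim: c f => // o c IH f ok; inversion ok; subst.
by rewrite /compile /= run_cat run_compile_op // IH.
Qed.

Lemma compile_op_ok o : op_ok o -> circuit_ok (compile_op o).
Proof.
case: o => [q|c t|a b t]; rewrite /op_ok => u.
- by constructor; [exact: uX_unitary|constructor].
- constructor; last by constructor.
  by move=> /iotaI e; move: u; rewrite e /= mem_head.
- apply: ccx_ok.
  by rewrite -[[:: _; _; _]]/(map iota [:: a; b; t]) map_inj_uniq.
Qed.

Lemma compile_ok c : ops_ok c -> circuit_ok (compile c).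
Proof.
elim: c => [|o c IH] ok; first by constructor.
inversion ok; subst; apply/circuit_ok_cat; split; [exact: compile_op_ok|exact: IH].
Qed.

Lemma compile_cat c1 c2 : compile (c1 ++ c2) = compile c1 ++ compile c2.
Proof. by rewrite /compile map_cat flatten_cat. Qed.

Lemma csupp_compile c : {subset csupp (compile c) <= map iota (supp c)}.
Proof.
elim: c => // o c IH j; rewrite /compile /= -/(compile c) csupp_cat supp_cons map_cat !mem_cat.
case/orP => [|/IH ->]; last by rewrite orbT.
case: o => [q|x t|a b t] /= h; apply/orP; left; move: h; rewrite /csupp //= !inE.
by repeat (case: (j == _) => //=).
Qed.

(** The worst case is the Toffoli gate, with 17 gates in [ccz] and two Hadamard gates. *)
Lemma size_compile c : (size (compile c) <= 19 * size c)%N.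
Proof.
elim: c => // o c IH; rewrite /compile /= -/(compile c) size_cat mulnS leq_add //.
by case: o.
Qed.

Lemma depth_compile c D : dep c D -> depth_le (compile c) (19 * D)%N.
Proof.
elim=> {c D} [|o|c1 c2 D1 D2 _ h1 _ h2|c1 c2 D dis _ h1 _ h2|c D D' _ h le].
- exact: depth_le_size.
- exact: depth_leW (depth_le_size _) (size_compile _).
- by rewrite compile_cat mulnDr; exact: depth_le_cat.
- rewrite compile_cat; apply: depth_le_par => //.
  apply: contra dis => /hasP[j /csupp_compile /mapP[q2 q2s ->] /csupp_compile].
  by rewrite mem_map // => q1s; apply/hasP; exists q2.
- by apply: depth_leW h _; rewrite leq_mul2l le.
Qed.
End Compile.

(** * Spreading an amplitude *)

Section Spread.
Variables (N : nat) (al : 'I_N -> CC).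

Definition weight (t : tree 'I_N) : CC := \sum_(i <- leaves t) `|al i| ^+ 2.

Lemma weight_ge0 t : 0 <= weight t.
Proof. by apply: sumr_ge0 => i _; rewrite exprn_ge0. Qed.

Lemma weight_node l r : weight (Node l r) = weight l + weight r.
Proof. by rewrite /weight big_cat. Qed.

(** The value at 0 is chosen of modulus 1, so that the phase gate is unitary for every amplitude. *)
Definition phase (z : CC) : CC := if z == 0 then 1 else z / `|z|.

Lemma phase_norm z : `|phase z| = 1.
Proof.
rewrite /phase; case: eqP => [_|/eqP nz]; first exact: normr1.
by rewrite normrM normfV normr_id divff // normr_eq0.
Qed.

Lemma norm_phase z : `|z| * phase z = z.
Proof.
rewrite /phase; case: eqP => [->|/eqP nz]; first by rewrite normr0 mul0r.
by rewrite mulrCA divff ?mulr1 // normr_eq0.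
Qed.

(* If both weights vanish then the ratio is 0, and so is the amplitude to be split. *)
Definition ratio (l r : tree 'I_N) : CC := sqrtC (weight r / (weight l + weight r)).

Lemma ratio_ge0 l r : 0 <= ratio l r.
Proof. by rewrite sqrtC_ge0 divr_ge0 ?addr_ge0 ?weight_ge0. Qed.

Lemma ratio_sqr_le1 l r : weight r / (weight l + weight r) <= 1.
Proof.
have l0 := weight_ge0 l; have r0 := weight_ge0 r.
have [e|nz] := eqVneq (weight l + weight r) 0; first by rewrite e invr0 mulr0.
rewrite ler_pdivrMr ?mul1r ?lerDr //.
by rewrite lt_def nz addr_ge0.
Qed.

Lemma ratio_le1 l r : ratio l r <= 1.
Proof.
rewrite -sqrtC1 ler_sqrtC ?ratio_sqr_le1 // qualifE /= ?ler01 //.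
by rewrite divr_ge0 ?addr_ge0 ?weight_ge0.
Qed.

Lemma sqrt_weight_left l r :
  sqrtC (weight (Node l r)) * sqrtC (1 - ratio l r ^+ 2) = sqrtC (weight l).
Proof.
have l0 := weight_ge0 l; have r0 := weight_ge0 r.
rewrite weight_node /ratio sqrtCK -rootCMl ?addr_ge0 //; congr sqrtC.
have [e|nz] := eqVneq (weight l + weight r) 0; last by field.
rewrite e mul0r; apply/eqP; rewrite eq_sym eq_le l0 andbT -e lerDl //.
Qed.

Lemma sqrt_weight_right l r :
  sqrtC (weight (Node l r)) * ratio l r = sqrtC (weight r).
Proof.
have l0 := weight_ge0 l; have r0 := weight_ge0 r.
rewrite weight_node /ratio -rootCMl ?addr_ge0 //; congr sqrtC.
have [e|nz] := eqVneq (weight l + weight r) 0; last by field.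
rewrite e mul0r; apply/eqP; rewrite eq_sym eq_le r0 andbT -e lerDr //.
Qed.

(** The splittings have real nonnegative coefficients and distribute the moduli only; the gate at
    each leaf supplies the argument of its amplitude. *)
Fixpoint spread (t : tree 'I_N) : circuit N :=
  match t with
  | Leaf i => [:: G1 i (uP (phase (al i)))]
  | Node l r => amp_split (thead l) (thead r) (ratio l r) ++ spread l ++ spread r
  end.

Lemma spread_node l r : spread (Node l r) =
  amp_split (thead l) (thead r) (ratio l r) ++ spread l ++ spread r.
Proof. by []. Qed.

Lemma uniq_node (T : eqType) (l r : tree T) : uniq (leaves (Node l r)) =
  [&& uniq (leaves l), ~~ has (mem (leaves l)) (leaves r) & uniq (leaves r)].
Proof. exact: cat_uniq. Qed.

Lemma thead_neq l r : uniq (leaves (Node l r)) -> thead l <> thead r :> 'I_N.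
Proof.
rewrite /= cat_uniq => /and3P[_ /hasPn dis _] e.
by have := dis _ (thead_leaves r); rewrite /= -e thead_leaves.
Qed.

Lemma run_spread0 t (y : bits N) : uniq (leaves t) -> (forall i, i \in leaves t -> y i = false) ->
  run (spread t) (ket y) = ket y.
Proof.
elim: t => [i|l IHl r IHr] u z.
  by rewrite [LHS]apply_P_ket z ?inE // scl1.
have ne := thead_neq u; move: u; rewrite uniq_node spread_node => /and3P[ul _ ur].
rewrite !run_cat run_amp_split ?ratio_ge0 ?ratio_le1 ?z ?mem_cat ?thead_leaves ?orbT //.
by rewrite IHl ?IHr // => i il; apply: z; rewrite /= mem_cat il ?orbT.
Qed.

(** The factor [sqrtC (weight t)] replaces a normalisation of the amplitudes, so subtrees of weight
    0 need no separate treatment in the induction. *)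
Lemma run_spread t (y : bits N) : uniq (leaves t) -> (forall i, i \in leaves t -> y i = false) ->
  scl (sqrtC (weight t)) (run (spread t) (ket (setbit y (thead t) true))) =
  superpose (leaves t) predT al (fun i => ket (setbit y i true)).
Proof.
elim: t y => [i|l IHl r IHr] y u z.
  rewrite [run _ _]apply_P_ket setbitE eqxx scl_scl /weight /= big_seq1 sqrCK //.
  rewrite norm_phase superpose_cons superpose_nil /=.
  by apply: functional_extensionality => x; rewrite /add addr0.
have ne := thead_neq u; move: u; rewrite uniq_node spread_node => /and3P[ul /hasPn dis ur].
have zl i : i \in leaves l -> y i = false by move=> il; apply: z; rewrite /= mem_cat il.
have zr i : i \in leaves r -> y i = false.
  by move=> ir; apply: z; rewrite /= mem_cat ir orbT.
have nlr i j : i \in leaves l -> j \in leaves r -> (i == j) = false.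
  by move=> il jr; apply/eqP => e; have := dis _ jr; rewrite /= -e il.
rewrite !run_cat run_amp_split ?ratio_ge0 ?ratio_le1 //; last first.
  by rewrite setbitE eq_sym (introF eqP ne) zr // thead_leaves.
rewrite setbitE eqxx !setbit_setbit.
have -> : setbit y (thead l) false = y by rewrite -{2}(setbit_id y (thead l)) zl ?thead_leaves.
rewrite !run_add !run_scl scl_add !scl_scl sqrt_weight_left sqrt_weight_right.
(* After the split each branch excites one subtree; the circuit of the other subtree acts trivially
   on it by [run_spread0]. *)
rewrite -run_scl IHl // run_superpose superpose_cat; congr add.
  apply: eq_superpose => i il _; apply: run_spread0 => // j jr.
  by rewrite setbitE eq_sym (nlr i j) // zr.
rewrite (run_spread0 (t := l)) ?IHr // => i il.
by rewrite setbitE (nlr i) ?thead_leaves // zl.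
Qed.

Lemma spread_ok t : uniq (leaves t) -> circuit_ok (spread t).
Proof.
elim: t => [i|l IHl r IHr] u.
  by constructor; [exact/uP_unitary/phase_norm|constructor].
have ne := thead_neq u; move: u; rewrite uniq_node spread_node => /and3P[ul _ ur].
apply/circuit_ok_cat; split; first exact: amp_split_ok (ratio_ge0 _ _) (ratio_le1 _ _) ne.
by apply/circuit_ok_cat; split; [exact: IHl|exact: IHr].
Qed.

Lemma csupp_spread t : {subset csupp (spread t) <= leaves t}.
Proof.
elim: t => [i|l IHl r IHr] j; first by rewrite /csupp /=.
rewrite spread_node !csupp_cat !mem_cat => /or3P[|/IHl ->|/IHr ->]; rewrite ?orbT //.
have hl := thead_leaves l; have hr := thead_leaves r.
rewrite /csupp /= !inE => h.
have /orP[] : (j == thead l) || (j == thead r).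
  by move: h; case: (j == thead l); case: (j == thead r).
- by move/eqP ->; rewrite hl.
- by move/eqP ->; rewrite hr orbT.
Qed.

Lemma depth_spread t : uniq (leaves t) -> depth_le (spread t) (4 * height t + 1)%N.
Proof.
elim: t => [i|l IHl r IHr] u; first exact: depth_le_size.
move: u; rewrite uniq_node spread_node => /and3P[ul /hasPn dis ur].
rewrite [height _]/= mulnS -addnA; apply: depth_le_cat; first exact: (depth_le_size (amp_split _ _ _)).
apply: depth_le_par.
- apply/hasPn => j /csupp_spread jr; apply/negP => /csupp_spread jl.
  by have := dis _ jr; rewrite /= jl.
- by apply: depth_leW (IHl ul) _; rewrite leq_add2r leq_mul2l leq_maxl.
- by apply: depth_leW (IHr ur) _; rewrite leq_add2r leq_mul2l leq_maxr.
Qed.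

Lemma size_spread t : (size (spread t) <= 5 * size (leaves t))%N.
Proof.
suff : (size (spread t) <= 1 + 5 * (size (leaves t)).-1)%N.
  by rewrite (leaves_cons t) /=; lia.
elim: t => // l IHl r IHr /=; rewrite !size_cat.
move: IHl IHr; rewrite (leaves_cons l) (leaves_cons r) /=; lia.
Qed.
End Spread.

(** * Effect of one batch on the partially loaded state *)

Section Batch.
Variables (N : nat) (V J : finType) (kappa : V -> 'I_N) (v0 : V).
Variables (q : J -> {ffun V -> bool}) (al : J -> CC).
Hypotheses (qI : injective q) (q0 : forall j, q j v0 = false).

Definition register (r : {ffun V -> bool}) : bits N :=
  [ffun j => [exists v, (kappa v == j) && r v]].

Definition flagged : {ffun V -> bool} := [ffun v => v == v0].

Definition remaining (D : {pred J}) : CC := \sum_(j | j \notin D) `|al j| ^+ 2.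

(* The items of [D] are loaded; the other amplitudes still sit on the flag. *)
Definition progress (D : {pred J}) : state N :=
  add (superpose (enum J) (mem D) al (fun j => ket (register (q j))))
      (scl (sqrtC (remaining D)) (ket (register flagged))).

Lemma remaining_ge0 D : 0 <= remaining D.
Proof. by apply: sumr_ge0 => j _; rewrite exprn_ge0. Qed.

Variables (D A D' : {pred J}).
Hypothesis DA : forall j, (j \in D') = (j \in D) || (j \in A).
Hypothesis disDA : forall j, j \in A -> j \notin D.

Notation I := {j in A}.

Lemma remaining_split :
  remaining D = remaining D' + \sum_(i : I) `|al (val i)| ^+ 2.
Proof.
rewrite /remaining -(big_sub _ (fun j => `|al j| ^+ 2)) [LHS](bigID (mem A)) /= addrC; congr (_ + _).
  by apply: eq_bigl => j; rewrite DA negb_or.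
apply: eq_bigl => j; case: (boolP (j \in A)) => [/disDA ->|] //.
by rewrite andbF.
Qed.

Variables (Rest : finType) (iota : V + (I + Rest) -> 'I_N).
Hypotheses (iotaI : injective iota) (iotaV : forall v, iota (inl v) = kappa v).

(** Between batches only the positions [kappa] are remembered, so each batch may embed its own index
    type and ancillas afresh. *)
Lemma register_basis r : register r = emb iota (basis_st Rest r (hot None)).
Proof.
apply/ffunP => j; rewrite !ffunE; apply/existsP/existsP.
  by move=> [v /andP[vj rv]]; exists (inl v); rewrite iotaV vj ffunE.
move=> [[v|[i|x]] /andP[e]]; rewrite !ffunE // => rv.
by exists v; rewrite -iotaV e.
Qed.

Definition excite (i : I) : 'I_N := iota (inr (inl i)).

Lemma setbit_register0 v : setbit (register [ffun=> false]) (kappa v) true =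
  register [ffun v' => v' == v].
Proof.
rewrite !register_basis -iotaV -emb_upd //; congr emb.
apply/ffunP => -[v'|[i|x]]; rewrite updE !ffunE //.
by rewrite (inj_eq (@inl_inj _ _)); case: eqP.
Qed.

Lemma setbit_excite i : setbit (register [ffun=> false]) (excite i) true =
  emb iota (basis_st Rest [ffun=> false] (hot (Some i))).
Proof.
rewrite register_basis -emb_upd //; congr emb.
apply/ffunP => -[v'|[j|x]]; rewrite updE !ffunE //.
by rewrite (inj_eq (@inr_inj _ _)) (inj_eq (@inl_inj _ _)) (inj_eq Some_inj) (eq_sym i); case: (j == i).
Qed.

Variables (h : nat) (cl : seq (op (V + (I + Rest)))) (dcl : nat).
Hypotheses (hI : (#|{: I}| < 2 ^ h)%N) (clP : loads (fun i : I => q (val i)) cl).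
Hypotheses (clok : ops_ok cl) (cldep : dep cl dcl).

(** The flag is itself a leaf of the tree: it retains the amplitude of everything still to be loaded
    after this batch. It is the only leaf that receives the default value. *)
Definition batch_al (j : 'I_N) : CC :=
  if [pick i | excite i == j] is Some i then al (val i) else sqrtC (remaining D').

Lemma batch_al_excite i : batch_al (excite i) = al (val i).
Proof.
rewrite /batch_al; case: pickP => [i' /eqP /iotaI [->]//|/(_ i)].
by rewrite eqxx.
Qed.

Lemma batch_al_flag : batch_al (kappa v0) = sqrtC (remaining D').
Proof. by rewrite /batch_al; case: pickP => // i; rewrite -iotaV => /eqP /iotaI. Qed.

Definition batch_tree : tree 'I_N := mktree h (kappa v0) (map excite (enum {: I})).

Lemma leaves_batch_tree : leaves batch_tree = kappa v0 :: map excite (enum {: I}).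
Proof. by apply: leaves_mktree; rewrite size_map -cardE. Qed.

Lemma uniq_batch_tree : uniq (leaves batch_tree).
Proof.
rewrite leaves_batch_tree cons_uniq; apply/andP; split.
  by apply/mapP => -[i _]; rewrite -iotaV => /iotaI.
by rewrite map_inj_uniq ?enum_uniq // => i i' /iotaI [].
Qed.

Definition batch : circuit N := spread batch_al batch_tree ++ compile iota cl.

Lemma run_batch : run batch (progress D) = progress D'.
Proof.
have u := uniq_batch_tree; have lE := leaves_batch_tree.
have rE (r : {ffun V -> bool}) i : i \in leaves batch_tree -> r v0 = false -> register r i = false.
  rewrite lE inE => /orP[/eqP ->|/mapP[k _ ->]] r0; rewrite register_basis.
    by rewrite -iotaV embE // ffunE.
  by rewrite embE // !ffunE.
rewrite /batch run_cat /progress run_add run_superpose run_scl.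
(* A loaded item has flag 0 and no excited index, so the tree finds nothing to split. *)
rewrite (@eq_superpose _ _ _ _ _ _ (fun j => ket (register (q j)))); last first.
  by move=> j _ _; apply: run_spread0 => // i it; exact: rE.
have -> : remaining D = weight batch_al batch_tree.
  rewrite remaining_split /weight lE big_cons batch_al_flag big_map big_enum /=.
  rewrite ger0_norm ?sqrtC_ge0 ?remaining_ge0 // sqrtCK; congr (_ + _).
  by apply: eq_bigr => i _; rewrite batch_al_excite.
have -> : register flagged = setbit (register [ffun=> false]) (thead batch_tree) true.
  by rewrite thead_mktree setbit_register0.
rewrite run_spread //; last by move=> i it; rewrite rE // ffunE.
have [cl1 cl2] := clP.
rewrite run_add !run_superpose lE superpose_cons /=.
rewrite (@eq_superpose _ _ _ _ _ _ (fun j => ket (register (q j)))); last first.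
  move=> j _ jD; rewrite register_basis run_compile // cl1 // => i /qI e.
  by have := disDA (valP i); rewrite -e => /negP; apply.
(* The flag bit separates the undistributed state from all items, so loading fixes it. *)
rewrite setbit_register0 batch_al_flag register_basis run_compile // cl1 -?register_basis; last first.
  by move=> i /ffunP /(_ v0); rewrite !ffunE q0 eqxx.
apply: functional_extensionality => x; rewrite /add /scl /superpose.
rewrite (big_map excite) !big_enum_cond /= [thead batch_tree]thead_mktree setbit_register0.
have -> : \sum_(i : I) batch_al (excite i) *
    run (compile iota cl) (ket (setbit (register [ffun=> false]) (excite i) true)) x =
  \sum_(j in A) al j * ket (register (q j)) x.
  rewrite (big_sub _ (fun j => al j * ket (register (q j)) x)); apply: eq_bigr => i _.
  by rewrite batch_al_excite setbit_excite run_compile // cl2 -register_basis.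
rewrite addrCA addrC; congr (_ + _).
rewrite [RHS](bigID (mem D)) /=; congr (_ + _).
  by apply: eq_bigl => j; rewrite DA; case: (j \in D); rewrite ?andbF.
apply: eq_bigl => j; rewrite DA; case: (boolP (j \in A)) => [/disDA ->|]; first by rewrite orbT.
by rewrite orbF andbN.
Qed.

Lemma batch_ok : circuit_ok batch.
Proof.
apply/circuit_ok_cat; split; first exact/spread_ok/uniq_batch_tree.
exact: compile_ok.
Qed.

Lemma depth_batch : depth_le batch ((4 * h + 1) + 19 * dcl)%N.
Proof.
apply: depth_le_cat; last exact: depth_compile.
apply: depth_leW (depth_spread _ uniq_batch_tree) _.
by rewrite leq_add2r leq_mul2l height_mktree.
Qed.

Lemma size_batch : (size batch <= 5 * (#|{: I}|.+1) + 19 * size cl)%N.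
Proof.
rewrite size_cat leq_add ?size_compile //.
apply: leq_trans (size_spread _ _) _.
by rewrite leaves_batch_tree /= size_map -cardE.
Qed.
End Batch.
(** * Composition of the batches *)

Section Assembly.
Variables (n d m : nat).
Hypothesis m0 : (0 < m)%N.
Variables (q : 'I_d -> bits n) (al : 'I_d -> CC).
Hypotheses (qI : injective q) (al1 : \sum_(i < d) `|al i| ^+ 2 = 1).

Notation V := 'I_n.+1.

(** The additional last bit is the flag, which [reg_pos] puts on the first ancilla. *)
Definition extend (x : bits n) : {ffun V -> bool} :=
  [ffun v : V => [exists i : 'I_n, (val i == val v) && x i]].

Lemma extendI : injective (fun j => extend (q j)).
Proof.
move=> j k /ffunP e; apply: qI; apply/ffunP => i.
have E x : extend x (widen_ord (leqnSn n) i) = x i.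
  rewrite ffunE; apply/existsP/idP => [[i' /andP[/eqP /= /ord_inj ->]]|xi] //.
  by exists i; rewrite eqxx.
by move: (e (widen_ord (leqnSn n) i)); rewrite !E.
Qed.

Lemma extend_flag j : extend (q j) ord_max = false.
Proof.
by rewrite ffunE; apply/existsP => -[i /andP[/eqP e]]; have := ltn_ord i; rewrite e ltnn.
Qed.

Lemma reg_bound : (n.+1 <= n + m)%N.
Proof. by rewrite -addn1 leq_add2l. Qed.

Definition reg_pos (v : V) : 'I_(n + m) := widen_ord reg_bound v.

Section Place.
Variable A : finType.
Hypothesis hA : (n.+1 + #|A| <= n + m)%N.

Definition place_val (x : V + A) : nat :=
  match x with inl v => v | inr a => n.+1 + enum_rank a end.

Lemma place_lt x : (place_val x < n + m)%N.
Proof.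
apply: leq_trans hA; case: x => [v|a] /=; first exact: leq_trans (ltn_ord v) (leq_addr _ _).
by rewrite ltn_add2l ltn_ord.
Qed.

Definition place (x : V + A) : 'I_(n + m) := Ordinal (place_lt x).

Lemma placeI : injective place.
Proof.
move=> [v|a] [v'|a'] [] => [/ord_inj ->//|e|e|/addnI /ord_inj /enum_rank_inj -> //].
  by have := ltn_ord v; rewrite e ltnNge leq_addr.
by have := ltn_ord v'; rewrite -e ltnNge leq_addr.
Qed.

Lemma place_reg v : place (inl v) = reg_pos v.
Proof. exact: val_inj. Qed.
End Place.

Definition loaded (k t : nat) : {pred 'I_d} := [pred j : 'I_d | (j %/ k < t)%N].
Definition chunk (k t : nat) : {pred 'I_d} := [pred j : 'I_d | (j %/ k == t)%N].

Definition prog (D : {pred 'I_d}) : state (n + m) :=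
  progress reg_pos ord_max (fun j => extend (q j)) al D.

Lemma loadedS k t j : (j \in loaded k t.+1) = (j \in loaded k t) || (j \in chunk k t).
Proof. by rewrite !inE ltnS leq_eqVlt orbC. Qed.

Lemma chunk_loaded k t j : j \in chunk k t -> j \notin loaded k t.
Proof. by rewrite !inE => /eqP ->; rewrite ltnn. Qed.

Lemma card_chunk k t : (0 < k)%N -> (#|{: {j in chunk k t}}| <= k)%N.
Proof.
move=> k0; rewrite -[leqRHS]card_ord.
have lt (i : {j in chunk k t}) : (val i %% k < k)%N by rewrite ltn_mod.
apply: (@leq_card _ _ (fun i => Ordinal (lt i))) => i i' [] e.
apply/val_inj/ord_inj; have := valP i; have := valP i'; rewrite !inE => /eqP c' /eqP c.
by rewrite (divn_eq (val i) k) (divn_eq (val i') k) e c c'.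
Qed.

(** A single X raises the flag, which then carries the whole norm 1; after [T] batches nothing
    remains to be distributed, so the flagged term has amplitude 0 and all ancillas are clean. *)
Lemma assemble k T Db Sb : (0 < k)%N -> (d <= T * k)%N ->
  (forall t, exists b : circuit (n + m),
     [/\ circuit_ok b, run b (prog (loaded k t)) = prog (loaded k t.+1),
         depth_le b Db & (size b <= Sb)%N]) ->
  exists c : circuit (n + m),
    [/\ circuit_ok c,
        forall x, run c (ket (join (zeros n) (zeros m))) x =
          \sum_(i < d) al i * ket (join (q i) (zeros m)) x,
        depth_le c (1 + T * Db)%N & (size c <= 1 + T * Sb)%N].
Proof.
move=> k0 dT B.
have [c [cok crun cd cs]] : exists c : circuit (n + m),
    [/\ circuit_ok c, run c (prog (loaded k 0)) = prog (loaded k T),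
        depth_le c (T * Db)%N & (size c <= T * Sb)%N].
  elim: (T) => [|t [c [cok crun cd cs]]].
    by exists [::]; split=> //; first [exact: depth_le_size|constructor].
  have [b [bok brun bd bs]] := B t; exists (c ++ b); split.
  - exact/circuit_ok_cat.
  - by rewrite run_cat crun brun.
  - by rewrite mulSn (addnC Db); exact: depth_le_cat.
  - by rewrite size_cat mulSn (addnC Sb) leq_add.
exists (G1 (reg_pos ord_max) uX :: c); split.
- by constructor; [exact: uX_unitary|].
- move=> x; rewrite -[run _ _]/(run c (apply_gate _ _)) apply_X_ket.
  have J0 k' : join (zeros n) (zeros m) k' = false.
    by rewrite ffunE; case: fintype.split => ?; rewrite ffunE.
  have -> : ket (setbit (join (zeros n) (zeros m)) (reg_pos ord_max)
      (~~ join (zeros n) (zeros m) (reg_pos ord_max))) = prog (loaded k 0).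
    apply: functional_extensionality => z; rewrite /prog /progress /add /scl /superpose.
    have l0 j : (j \in loaded k 0) = false by [].
    rewrite big_pred0 ?add0r /remaining //.
    rewrite (eq_bigl xpredT) ?al1; last by move=> j; rewrite l0.
    rewrite sqrtC1 mul1r; congr (ket _ _).
    apply/ffunP => j; rewrite setbitE !J0 ffunE.
    apply/idP/existsP => [|[v /andP[/eqP <-]]]; last by rewrite ffunE => /eqP ->; rewrite eqxx.
    by case: eqP => // -> _; exists ord_max; rewrite ffunE !eqxx.
  rewrite crun /prog /progress /add /scl /superpose.
  have dn j : j \in loaded k T by rewrite inE ltn_divLR // (leq_trans (ltn_ord j)).
  rewrite /remaining [X in sqrtC X]big_pred0 ?sqrtC0 ?mul0r ?addr0; last by move=> j; rewrite dn.
  rewrite big_enum_cond /=; apply: eq_big => [j|j _]; first by rewrite dn.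
  congr (_ * ket _ _); apply/ffunP => i; rewrite !ffunE.
  case: split_ordP => i' ->.
    apply/existsP/idP => [[v /andP[/eqP e]]|qi].
      rewrite ffunE => /existsP[i0 /andP[/eqP e0]].
      by have -> : i0 = i' by apply/ord_inj; rewrite e0 -[LHS]/(val (reg_pos v)) e.
    exists (widen_ord (leqnSn n) i'); apply/andP; split; first exact/eqP/val_inj.
    by rewrite ffunE; apply/existsP; exists i'; rewrite eqxx.
  rewrite ffunE; apply/existsP => -[v /andP[/eqP e]].
  rewrite ffunE => /existsP[i0 /andP[/eqP e0 _]].
  have := congr1 val e; rewrite /= -e0 => e1.
  by have := ltn_ord i0; rewrite e1 ltnNge leq_addr.
- exact: (depth_le_cat (depth_le_size [:: _]) cd).
- by rewrite /= -add1n leq_add2l.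
Qed.

Lemma chunk_batch k t h (Rest : finType) (cl : seq (op (V + ({j in chunk k t} + Rest)))) dcl :
  (0 < k)%N -> (k < 2 ^ h)%N -> (n.+1 + (k + #|Rest|) <= n + m)%N ->
  loads (fun i : {j in chunk k t} => extend (q (val i))) cl ->
  ops_ok cl -> dep cl dcl ->
  exists b : circuit (n + m),
    [/\ circuit_ok b, run b (prog (loaded k t)) = prog (loaded k t.+1),
        depth_le b (4 * h + 1 + 19 * dcl)%N & (size b <= 5 * k.+1 + 19 * size cl)%N].
Proof.
move=> k0 kh fit lo ok dp; have ck := card_chunk t k0.
have hA : (n.+1 + #|{: {j in chunk k t} + Rest}| <= n + m)%N.
  by apply: leq_trans fit; rewrite card_sum leq_add2l leq_add2r.
have hI := leq_ltn_trans ck kh.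
exists (batch reg_pos ord_max al (loaded k t.+1) (place hA) h cl); split.
- exact: (batch_ok _ _ _ (@placeI _ hA) (place_reg hA) hI ok).
- exact: (run_batch _ extendI extend_flag (loadedS k t) (@chunk_loaded k t)
     (@placeI _ hA) (place_reg hA) hI lo ok).
- exact: (depth_batch _ _ _ (@placeI _ hA) (place_reg hA) hI dp).
- have sb := @size_batch _ _ _ reg_pos ord_max al _ (loaded k t.+1) _ (place hA) h cl hI.
  apply: leq_trans sb _.
  by rewrite leq_add2r leq_mul2l ltnS ck.
Qed.

(** The ancillas are the flag, one index and two qubits for each of [n.+1] edges. The constants come
    from [4 * h + 1 + 19 * (12 * h + 6)] and [5 * 2 + 19 * (17 * n.+1 + 1)]. *)
Lemma prepare_sequential h : (2 * n + 4 <= m)%N -> (n.+1 < 2 ^ h)%N ->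
  exists c : circuit (n + m),
    [/\ circuit_ok c,
        forall x, run c (ket (join (zeros n) (zeros m))) x =
          \sum_(i < d) al i * ket (join (q i) (zeros m)) x,
        depth_le c (1 + d * (232 * h + 115))%N & (size c <= 1 + d * (323 * n.+1 + 29))%N].
Proof.
move=> fit hn.
apply: (assemble (k := 1)) => //; first by rewrite muln1.
move=> t; have c1 := card_chunk t (ltn0Sn 0).
have cE : (#|{: V * {j in chunk 1 t}}| <= n.+1)%N.
  by rewrite card_prod card_ord -[leqRHS]muln1 leq_mul2l c1 orbT.
have hE := leq_ltn_trans cE hn.
have inj : injective (fun i : {j in chunk 1 t} => extend (q (val i))).
  by move=> i i' /extendI /val_inj.
have [] := chunk_batch (k := 1) (t := t) (h := h) (ltn0Sn 0) _ _ (loads1 inj hE)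
   (load1_ok _ hE) (dep_load1 _ hE).
- by apply: leq_ltn_trans hn.
- rewrite card_sum; move: cE; set e := #|_|; move: e => e; lia.
move=> b [bok br bd bs]; exists b; split=> //.
- apply: depth_leW bd _; lia.
- apply: leq_trans bs _.
  have := size_load1 (fun i : {j in chunk 1 t} => extend (q (val i))) hE.
  rewrite card_ord; move: cE c1; set e := #|_|; set i := #|_|; set s := size _.
  move: e i s => e i s; lia.
Qed.

(** The ancilla condition counts the flag, the index, the word nodes, and two qubits per edge of
    either layer. The depth is [4 * h + 1 + 19 * (24 * h + 14)]; in the size, nodes, bits and
    indices are absorbed by the two edge counts. *)
Lemma prepare_parallel s k T h : (0 < s)%N -> (0 < k)%N -> (d <= T * k)%N ->
  (k < 2 ^ h)%N -> ((n %/ s).+1 * k < 2 ^ h)%N -> (n.+1 * 2 ^ s < 2 ^ h)%N ->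
  (1 + k + (n %/ s).+1 * 2 ^ s + 2 * ((n %/ s).+1 * k) + 2 * (n.+1 * 2 ^ s) <= m)%N ->
  exists c : circuit (n + m),
    [/\ circuit_ok c,
        forall x, run c (ket (join (zeros n) (zeros m))) x =
          \sum_(i < d) al i * ket (join (q i) (zeros m)) x,
        depth_le c (1 + T * (460 * h + 267))%N &
        (size c <= 1 + T * (329 * ((n %/ s).+1 * k) + 409 * (n.+1 * 2 ^ s) + 29))%N].
Proof.
move=> s0 k0 dT kh h1 h2 fit.
apply: (assemble k0 dT) => t; have ck := card_chunk t k0.
have lb (v : V) : (v %/ s < (n %/ s).+1)%N by rewrite ltnS leq_div2r // -ltnS.
have lp (v : V) : (v %% s < s)%N by rewrite ltn_mod.
pose blk v := Ordinal (lb v); pose pos v := Ordinal (lp v).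
have bpI : injective (fun v => (blk v, pos v)).
  by move=> v v' [e1 e2]; apply: ord_inj; rewrite (divn_eq v s) (divn_eq v' s) e1 e2.
have inj : injective (fun i : {j in chunk k t} => extend (q (val i))).
  by move=> i i' /extendI /val_inj.
have cw : #|word_t 'I_s| = (2 ^ s)%N by rewrite card_ffun card_bool card_ord.
have c1 : (#|edge1_t {j in chunk k t} 'I_(n %/ s).+1| <= (n %/ s).+1 * k)%N.
  by rewrite card_prod card_ord leq_mul2l ck orbT.
have c2 : #|edge2_t V 'I_s| = (n.+1 * 2 ^ s)%N by rewrite card_prod card_ord cw.
have c3 : #|node_t 'I_(n %/ s).+1 'I_s| = ((n %/ s).+1 * 2 ^ s)%N.
  by rewrite card_prod card_ord cw.
have hE1 := leq_ltn_trans c1 h1.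
have hE2 : (#|edge2_t V 'I_s| < 2 ^ h)%N by rewrite c2.
have [] := chunk_batch (k := k) (t := t) (h := h) k0 kh _ (loads2 bpI inj hE1 hE2)
   (load2_ok _ _ _ hE1 hE2) (dep_load2 _ _ _ hE1 hE2).
  rewrite /rest2 !card_sum c2 c3.
  move: c1 fit; set e := #|_|; move: e => e; lia.
move=> b [bok br bd bs]; exists b; split=> //.
- apply: depth_leW bd _; lia.
- apply: leq_trans bs _.
  have := size_load2 (fun i : {j in chunk k t} => extend (q (val i))) blk pos hE1 hE2.
  have c4 : ((n %/ s).+1 * 2 ^ s <= n.+1 * 2 ^ s)%N.
    by rewrite leq_mul2r ltnS leq_div orbT.
  have c5 : (k <= (n %/ s).+1 * k)%N by rewrite leq_pmull.
  have c6 : (n.+1 <= n.+1 * 2 ^ s)%N by rewrite leq_pmulr // expn_gt0.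
  rewrite c2 c3 card_ord; move: c1 ck c4 c5 c6.
  set e := #|edge1_t _ _|; set i := #|{: {j in chunk k t}}|; set z := size _.
  move: e i z ((n %/ s).+1 * 2 ^ s)%N ((n %/ s).+1 * k)%N (n.+1 * 2 ^ s)%N => e i z a b' c; lia.
Qed.
End Assembly.
(** * Choice of the parameters *)

Lemma ln2_gt0 : 0 < ln 2 :> R.
Proof.
apply/RltP; apply: Rlt_trans ln_lt_2; apply: Rinv_0_lt_compat; exact: Rlt_0_2.
Qed.

Lemma log2_pow2 a : log2 (2 ^+ a) = a%:R.
Proof.
have l2 : ln 2 != 0 by rewrite gt_eqF // ln2_gt0.
rewrite /log2 -RpowE ln_pow ?INRE.
  by rewrite RmultE mulfK.
by apply/RltP.
Qed.

Lemma ler_log2 (x y : R) : 0 < x -> x <= y -> log2 x <= log2 y.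
Proof.
move=> x0 xy; rewrite /log2 ler_pM2r ?invr_gt0 ?ln2_gt0 //.
move: xy; rewrite le_eqVlt => /orP[/eqP -> //|xy].
by apply/ltW/RltP/ln_increasing; apply/RltP.
Qed.

Lemma log2M (x y : R) : 0 < x -> 0 < y -> log2 (x * y)%R = log2 x + log2 y.
Proof.
by move=> /RltP x0 /RltP y0; rewrite /log2 -RmultE ln_mult // -mulrDl.
Qed.

Lemma leq_log2 a x : (2 ^ a <= x)%N -> a%:R <= log2 x%:R :> R.
Proof.
move=> h; rewrite -log2_pow2; apply: ler_log2; first by rewrite exprn_gt0.
by rewrite -natrX ler_nat.
Qed.

Lemma log2_leq (x : R) a : 0 < x -> x <= (2 ^ a)%:R -> log2 x <= a%:R.
Proof. by move=> x0 h; rewrite -log2_pow2; apply: ler_log2; rewrite // -natrX. Qed.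

Lemma ceil_div d k : (0 < k)%N -> (k <= d)%N ->
  exists T, [/\ (0 < T)%N, (d <= T * k)%N, (T * k <= 2 * d)%N & k = d -> T = 1%N].
Proof.
move=> k0 kd; exists ((d + k.-1) %/ k)%N.
have := divn_eq (d + k.-1) k; have := ltn_pmod (d + k.-1) k0.
set T := ((d + k.-1) %/ k)%N; move=> r e; split.
- by rewrite divn_gt0 //; lia.
- lia.
- lia.
- move=> kd'; rewrite /T -kd' -[X in (X + _)%N]mul1n divnMDl // divn_small ?addn0 //; lia.
Qed.

(* There are [T] batches of [k] items and blocks of [s] bits; every tree has at most
   [2 ^ h.+1] leaves.  Only [n * L] ancillas are used: [L] is capped at a multiple of [d]
   since more of them would not help. *)
Lemma parameters n d m : (0 < n)%N -> (1 < d)%N -> (d <= 2 ^ n)%N ->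
  (1024 * n <= m)%N ->
  exists s k T h L,
    [/\ (1 < s)%N, (0 < k)%N, (0 < T)%N & (d <= T * k)%N] /\
    [/\ (k < 2 ^ h.+1)%N, ((n %/ s).+1 * k < 2 ^ h.+1)%N, (n.+1 * 2 ^ s < 2 ^ h.+1)%N &
      (1 + k + (n %/ s).+1 * 2 ^ s + 2 * ((n %/ s).+1 * k) + 2 * (n.+1 * 2 ^ s) <= m)%N] /\
    [/\ (s * (T * ((n %/ s).+1 * k)) <= 13 * (n * d))%N,
        (s * (T * (n.+1 * 2 ^ s)) <= 4096 * (n * d))%N,
        (s * T <= 11 * (n * d))%N & (s <= 6 * (n * d))%N] /\
    [/\ (2 ^ h <= n * L)%N, (n * L <= m)%N, (L <= 1024 * d)%N &
        (L < 2 ^ (2 * s + 2))%N] /\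
    (L = m %/ n \/ L = 1024 * d)%N /\
    (T = 1 \/ L = m %/ n /\ T * (s * m) <= 256 * (n * d))%N.
Proof.
move=> n0 d1 d2n mn.
have Lm : (1024 <= m %/ n)%N by rewrite leq_divRL // mulnC mulnC.
pose L := minn (m %/ n) (1024 * d).
have L1024 : (1024 <= L)%N by rewrite leq_min Lm; lia.
have Lmn : (L <= m %/ n)%N by rewrite geq_minl.
have Ld : (L <= 1024 * d)%N by rewrite geq_minr.
have nLm : (n * L <= m)%N by rewrite mulnC -leq_divRL.
pose s := trunc_log 4 L.
(* Since [4 ^ 5 = 1024], the threshold on [m] gives [2 ^ s >= 32], hence [L %/ 32 >= 2 ^ s]. *)
have s5 : (5 <= s)%N by apply: trunc_log_max.
have sL : (4 ^ s <= L)%N by apply: trunc_logP => //; lia.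
have Ls : (L < 4 ^ s.+1)%N by apply: trunc_log_ltn.
have p22 : (4 ^ s = 2 ^ s * 2 ^ s)%N by rewrite -expnMn.
have p5 : (32 <= 2 ^ s)%N by rewrite (leq_pexp2l (m := 2) (n1 := 5)).
have s2 : (s <= 2 ^ s)%N by apply/ltnW/ltn_expl.
(* From [4 ^ s <= 1024 * d <= 2 ^ (10 + n)]. It bounds [s] by a multiple of [n], so that rounding up
   the number of blocks costs a constant factor only. *)
have s11 : (2 * s <= 11 * n)%N.
  have : (2 * s < 11 + n)%N.
    rewrite -(ltn_exp2l (m := 2)) // expnM expnD; apply: leq_ltn_trans sL _.
    apply: leq_ltn_trans Ld _; have : (0 < 2 ^ n)%N by rewrite expn_gt0.
    by rewrite (_ : 2 ^ 11 = 2 * 1024)%N //; lia.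
  lia.
pose k0 := (s * (L %/ 32))%N.
have L32 : (2 ^ s <= L %/ 32)%N by rewrite leq_divRL // (leq_trans _ sL) // p22 leq_mul2l p5 orbT.
have L32' : (L %/ 32 * 32 <= L)%N by rewrite leq_divM.
have L32'' : (L <= 64 * (L %/ 32))%N by clear - L1024; lia.
pose k := minn k0 d.
have k00 : (0 < k0)%N by rewrite muln_gt0 (leq_trans _ s5) // (leq_trans _ L32) // expn_gt0.
have k0' : (0 < k)%N by rewrite leq_min k00 ltnW.
have kd : (k <= d)%N by rewrite geq_minr.
have kk0 : (k <= k0)%N by rewrite geq_minl.
have [T [T0 dT Td T1]] := ceil_div k0' kd.
have n1 : (n.+1 <= 2 * n)%N by clear - n0; lia.
(* The word edges are paid for by the items. When [k] is cut down to [d], the cap on [L] saves the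
   bound: [s * 2 ^ s <= 4 ^ s <= L <= 1024 * d]. *)
have ss : (s * 2 ^ s <= 1024 * k)%N.
  rewrite /k; case: (leqP k0 d) => _.
    by rewrite /k0 mulnCA leq_mul2l (leq_trans L32) ?leq_pmull ?orbT.
  by apply: leq_trans Ld; apply: leq_trans sL; rewrite p22 leq_mul2r s2 orbT.
have ns : (s * (n %/ s) <= n)%N by rewrite mulnC leq_divM.
have nsn : ((n %/ s).+1 <= 2 * n)%N by apply: leq_trans n1; rewrite ltnS leq_div.
have b13 : (2 * (s * (n %/ s).+1) <= 13 * n)%N.
  by rewrite mulnS; move: ns s11; set x := (s * _)%N; move: x; clear; lia.
have nTk : (n * (T * k) <= 2 * (n * d))%N by rewrite [leqRHS]mulnCA leq_mul2l Td orbT.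
have Td2 : (T <= 2 * d)%N by apply: leq_trans Td; rewrite leq_pmulr.
have kL : (32 * k <= s * L)%N.
  apply: leq_trans (_ : 32 * k0 <= _)%N; first by rewrite leq_mul2l.
  by rewrite /k0 mulnCA leq_mul2l [X in (X <= _)%N]mulnC L32' orbT.
set b := (n %/ s).+1 in b13 nsn *.
set p := (2 ^ s)%N in L32 p5 s2 p22 ss *.
have e1 : (2 * (s * (T * (b * k))) <= 26 * (n * d))%N.
  apply: leq_trans (_ : (2 * (s * b)) * (T * k) <= _)%N; first by clear; lia.
  by apply: leq_trans (leq_mul b13 (leqnn _)) _; clear - nTk; lia.
have e2 : (s * (T * (n.+1 * p)) <= 4096 * (n * d))%N.
  apply: leq_trans (_ : T * (n.+1 * (s * p)) <= _)%N; first by clear; lia.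
  apply: leq_trans (leq_mul (leqnn T) (leq_mul n1 ss)) _.
  by clear - nTk; lia.
(* The divisor 32 in [k0] makes everything fit: in units of [n * L / 64], the item edges take 26,
   the indices 11, the word edges 8 and the nodes 4; the flag is at most [n * L / 1024]. *)
have q1 : (64 * (b * k) <= 13 * (n * L))%N.
  apply: leq_trans (_ : 2 * (s * b) * L <= _)%N.
    by have := leq_mul (leqnn (2 * b)) kL; clear; lia.
  by apply: leq_trans (leq_mul b13 (leqnn L)) _; clear; lia.
have q2 : (32 * p <= L)%N by clear - L32 L32'; lia.
have q3 : (n.+1 * (32 * p) <= 2 * n * L)%N by apply: leq_mul.
have q4 : (b * (32 * p) <= 2 * n * L)%N by apply: leq_mul.
have q5 : (64 * k <= 11 * (n * L))%N by have := leq_mul s11 (leqnn L); clear - kL; lia.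
have nL : (1024 <= n * L)%N by apply: leq_trans L1024 _; rewrite leq_pmull.
have h1 : (2 ^ trunc_log 2 (n * L) <= n * L)%N by apply: trunc_logP => //; clear - nL; lia.
have h2 : (n * L < 2 ^ (trunc_log 2 (n * L)).+1)%N by apply: trunc_log_ltn.
exists s, k, T, (trunc_log 2 (n * L)), L.
rewrite -/b -/p; clearbody b p; move: (2 ^ _.+1)%N h2 => H h2.
split; [|split; [|split; [|split; [|split]]]].
- by split=> //; exact: leq_trans s5.
- by clear - q1 q3 q4 q5 nL h2 nLm; split; lia.
- split.
  + by move: e1; clear; lia.
  + exact: e2.
  + by have := leq_mul s11 Td2; clear; lia.
  + have : (n <= n * d)%N by rewrite leq_pmulr // ltnW.
    by clear - s11; lia.
- by split=> //; rewrite (_ : 2 * s + 2 = 2 * s.+1)%N ?expnM //; clear; lia.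
- by rewrite /L; case: (leqP (m %/ n) (1024 * d)) => _; [left|right].
have [kd'|kd'] := leqP d k0; first by left; apply: T1; rewrite /k; apply/minn_idPr.
have kE : k = k0 by apply/minn_idPl/ltnW.
(* With [L] capped at [1024 * d], [k0] would be at least [L %/ 32 = 32 * d], and a single batch
   would do. *)
right; have LE : L = (m %/ n)%N.
  rewrite /L; apply/minn_idPl; rewrite leqNgt; apply/negP => lt.
  have LE : L = (1024 * d)%N by apply/minn_idPr/ltnW.
  have : (d <= k0)%N.
    apply: leq_trans (_ : L %/ 32 <= _)%N; first by rewrite LE leq_divRL //; clear; lia.
    by rewrite /k0 leq_pmull // (leq_trans _ s5).
  by rewrite leqNgt kd'.
split=> //.
have mL : (m <= 2 * (n * L))%N.
  have e := divn_eq m n; have r := ltn_pmod m n0.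
  have L0 : (n <= n * L)%N by rewrite leq_pmulr // (leq_trans _ L1024).
  by rewrite [leqLHS]e -LE (mulnC L); clear - r L0; lia.
have sm : (s * m <= 128 * (n * k))%N.
  apply: leq_trans (leq_mul (leqnn s) mL) _.
  apply: leq_trans (_ : 2 * (s * n) * (64 * (L %/ 32)) <= _)%N.
    by rewrite mulnCA [X in (2 * X)%N]mulnA mulnA leq_mul.
  by rewrite kE /k0; clear; lia.
apply: leq_trans (leq_mul (leqnn T) sm) _; clear - nTk; lia.
Qed.

(** * Comparison with the real-valued bounds *)

Section Bounds.
Variables (n d m : nat).
Hypotheses (n0 : (0 < n)%N) (d1 : (1 < d)%N) (mn : (6 * n <= m)%N).

Notation N := (n%:R : R).
Notation D := (d%:R : R).
Notation M := (m%:R : R).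

Definition depth_bound (C : R) : R :=
  C * (N * D * log2 M / (M * log2 (M / N)%R) + log2 (N * D)%R).
Definition size_bound (C : R) : R :=
  C * (N * D / log2 (M / N)%R + N * D / log2 D).

Let N1 : 1 <= N. Proof. by rewrite ler1n. Qed.
Let N0 : 0 < N. Proof. by rewrite ltr0n. Qed.
Let D2 : 2 <= D. Proof. by rewrite ler_nat. Qed.
Let MN : 6 * N <= M. Proof. by rewrite -natrM ler_nat. Qed.
Let lD : 1 <= log2 D.
Proof. by apply: (leq_log2 (a := 1)). Qed.
Let lND : 1 <= log2 (N * D)%R.
Proof. by rewrite -natrM; apply: (leq_log2 (a := 1)); rewrite (leq_trans d1) // leq_pmull. Qed.
Let lMN : 1 <= log2 (M / N)%R.
Proof.
apply: le_trans (_ : log2 2%:R <= _); first exact: (leq_log2 (a := 1)).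
have g : 2 * N <= M by move: N1 MN; lra.
by apply: ler_log2 => //; rewrite ler_pdivlMr.
Qed.
Let lM : 1 <= log2 M.
Proof. by apply: (leq_log2 (a := 1)); rewrite (leq_trans _ mn) // -[2%N]muln1 leq_mul. Qed.

Let M0 : 0 < M. Proof. by move: N1 MN; lra. Qed.
Let D0 : 0 < D. Proof. by move: D2; lra. Qed.
Let lMN0 : 0 < log2 (M / N)%R. Proof. exact: lt_le_trans lMN. Qed.
Let lD0 : 0 < log2 D. Proof. exact: lt_le_trans lD. Qed.
Let lM0 : 0 < log2 M. Proof. exact: lt_le_trans lM. Qed.

Let Nge0 : 0 <= N := ltW N0.
Let Dge0 : 0 <= D := ltW D0.
Let Mge0 : 0 <= M := ltW M0.
Let lMNge0 : 0 <= log2 (M / N)%R := ltW lMN0.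
Let lMge0 : 0 <= log2 M := ltW lM0.
Let lDge0 : 0 <= log2 D := ltW lD0.
Let lNDge0 : 0 <= log2 (N * D)%R := le_trans ler01 lND.

Ltac rlra := move: N1 D2 MN lD lND lMN lM; lra.

(** All logarithms involved are at least 1, so both summands are nonnegative and it suffices to stay
    below one of them, with denominators cleared. *)
Lemma depth_bound_left C A : 0 <= C -> A * (M * log2 (M / N)%R) <= C * (N * D * log2 M) ->
  A <= depth_bound C.
Proof.
move=> C0 h; have p : 0 < M * log2 (M / N)%R by exact: mulr_gt0.
apply: le_trans (_ : C * (N * D * log2 M / (M * log2 (M / N)%R)) <= _).
  by rewrite mulrA ler_pdivlMr.
by rewrite ler_wpM2l // lerDl.
Qed.

Lemma depth_bound_right C A : 0 <= C -> A <= C * log2 (N * D)%R -> A <= depth_bound C.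
Proof.
move=> C0 h; apply: le_trans h _; rewrite ler_wpM2l // lerDr.
exact: divr_ge0 (mulr_ge0 (mulr_ge0 Nge0 Dge0) lMge0) (mulr_ge0 Mge0 lMNge0).
Qed.

Lemma size_bound_left C A : 0 <= C -> A * log2 (M / N)%R <= C * (N * D) -> A <= size_bound C.
Proof.
move=> C0 h; apply: le_trans (_ : C * (N * D / log2 (M / N)%R) <= _).
  by rewrite mulrA ler_pdivlMr.
by rewrite ler_wpM2l // lerDl divr_ge0 // mulr_ge0.
Qed.

Lemma size_bound_right C A : 0 <= C -> A * log2 D <= C * (N * D) -> A <= size_bound C.
Proof.
move=> C0 h; apply: le_trans (_ : C * (N * D / log2 D) <= _).
  by rewrite mulrA ler_pdivlMr.
by rewrite ler_wpM2l // lerDr divr_ge0 // mulr_ge0.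
Qed.

(** With [m / n] below 1024 its logarithm is at most 10, so the denominator of the depth is at most
    [10240 * n] and the first summand already has the order [d * log m] of a sequential
    procedure. *)
Lemma sequential_bounds : (m < 1024 * n)%N ->
  exists h, [/\ (n.+1 < 2 ^ h)%N,
    (1 + d * (232 * h + 115))%:R <= depth_bound (10 * 1000 * 1000)%R &
    (1 + d * (323 * n.+1 + 29))%:R <= size_bound (10 * 1000 * 1000)%R].
Proof.
move=> mK; have nm : (n.+1 <= m)%N by clear - n0 mn; lia.
have MK : M <= 1024 * N by rewrite -natrM ler_nat ltnW.
have lg10 : log2 (M / N)%R <= 10.
  apply: (log2_leq (a := 10)); first exact: divr_gt0.
  by rewrite ler_pdivrMr // (_ : 2 ^ 10 = 1024)%N.
exists (trunc_log 2 n.+1).+1; split; first exact: trunc_log_ltn.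
  set h := trunc_log 2 n.+1.
  have hM : h%:R <= log2 M.
    by apply: leq_log2; apply: leq_trans nm; exact: trunc_logP.
  apply: depth_bound_left; first by rlra.
  rewrite natrD natrM natrD natrM -[h.+1]addn1 natrD.
  apply: le_trans (_ : 700 * (D * log2 M) * (10240 * N) <= _); last first.
    have : 0 <= N * D * log2 M by exact: (mulr_ge0 (mulr_ge0 Nge0 Dge0) lMge0).
    lra.
  apply: ler_pM.
  - by do ?[exact: ler0n | apply: addr_ge0 | apply: mulr_ge0].
  - by rewrite mulr_ge0.
  - have : D * h%:R <= D * log2 M by rewrite ler_wpM2l //; rlra.
    have : D * 1 <= D * log2 M by rewrite ler_wpM2l //; rlra.
    rlra.
  - apply: le_trans (_ : (1024 * N) * 10 <= _); last by rlra.
    by apply: ler_pM => //; rlra.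
apply: size_bound_left; first by rlra.
rewrite natrD natrM natrD natrM -[n.+1]addn1 natrD.
apply: le_trans (_ : 700 * (N * D) * 10 <= _); last first.
  have : 0 <= N * D by exact: (mulr_ge0 Nge0 Dge0).
    lra.
apply: ler_pM.
- by do ?[exact: ler0n | apply: addr_ge0 | apply: mulr_ge0].
- by rlra.
- have : 1 * D <= N * D by rewrite ler_wpM2r //; rlra.
  by rlra.
- by [].
Qed.

(** A single batch is charged to [log(nd)], because [n * L <= 1024 * n * d]. With several batches
    [T * s * m] is of order [n * d] and [s] of order [log(m/n)], which is the first summand of the
    depth. *)
Lemma parallel_bounds s k T h L :
  (1 < s)%N -> (0 < T)%N ->
  (s * (T * ((n %/ s).+1 * k)) <= 13 * (n * d))%N ->
  (s * (T * (n.+1 * 2 ^ s)) <= 4096 * (n * d))%N ->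
  (s * T <= 11 * (n * d))%N -> (s <= 6 * (n * d))%N ->
  (2 ^ h <= n * L)%N -> (n * L <= m)%N -> (L <= 1024 * d)%N ->
  (L < 2 ^ (2 * s + 2))%N ->
  (L = m %/ n \/ L = 1024 * d)%N ->
  (T = 1 \/ L = m %/ n /\ T * (s * m) <= 256 * (n * d))%N ->
  (1 + T * (460 * h.+1 + 267))%:R <= depth_bound (10 * 1000 * 1000)%R /\
  (1 + T * (329 * ((n %/ s).+1 * k) + 409 * (n.+1 * 2 ^ s) + 29))%:R
    <= size_bound (10 * 1000 * 1000)%R.
Proof.
move=> s1 T0 a1 a2 a3 a4 hL Lm Ld Ls LE TE.
have S2 : 2 <= s%:R :> R by rewrite ler_nat.
(* From [L < 2 ^ (2 * s + 2)], and [2 * s + 2 <= 3 * s] since [s >= 2]. *)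
have lgs : L = (m %/ n)%N -> log2 (M / N)%R <= 3 * s%:R.
  move=> e; apply: le_trans (_ : (2 * s + 2)%:R <= _); last by rewrite natrD natrM; rlra.
  apply: log2_leq; first exact: divr_gt0.
  rewrite ler_pdivrMr //.
  rewrite -natrM ler_nat; apply: ltnW; rewrite -ltn_divLR // -e //.
have H1 : 1 <= T%:R :> R by rewrite ler1n.
have ND0 : 2 <= N * D.
  by rewrite -natrM ler_nat (leq_trans d1) // leq_pmull.
split.
  have hl : h%:R <= log2 (n * L)%:R by exact: leq_log2.
  have nL0 : (0 < n * L)%N by apply: leq_trans hL; rewrite expn_gt0.
  have hM : h%:R <= log2 M.
    by apply: leq_log2; exact: leq_trans Lm.
  case: TE => [->|[e TE]].
    apply: depth_bound_right; first by rlra.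
    have h10 : log2 (n * L)%:R <= log2 (1024 * (N * D))%R.
      apply: ler_log2; first by rewrite ltr0n.
      by rewrite -!natrM ler_nat mulnCA leq_mul2l Ld orbT.
    have l10 : log2 1024%:R <= 10.
      by apply: (log2_leq (a := 10)); rewrite ?ltr0n ?ler_nat.
    rewrite log2M // in h10; last by rlra.
    by rewrite mul1n -[h.+1]addn1 !(natrD, natrM); rlra.
  apply: depth_bound_left; first by rlra.
  have TE' : T%:R * (s%:R * M) <= 256 * (N * D) by rewrite -!natrM ler_nat.
  apply: le_trans (_ : 2000 * (T%:R * log2 M) * (M * (3 * s%:R)) <= _).
    apply: ler_pM => //.
    - by rewrite mulr_ge0.
    - have : T%:R * h%:R <= T%:R * log2 M by rewrite ler_wpM2l //; rlra.
      have : T%:R * 1 <= T%:R * log2 M by rewrite ler_wpM2l //; rlra.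
      by rewrite -[h.+1]addn1 !(natrD, natrM); rlra.
    - by rewrite ler_wpM2l ?lgs //; rlra.
  rewrite (_ : _ * _ = 6000 * log2 M * (T%:R * (s%:R * M))); last by ring.
  apply: le_trans (_ : 6000 * log2 M * (256 * (N * D)) <= _).
    by rewrite ler_wpM2l //; rlra.
  have : 0 <= N * D * log2 M by exact: (mulr_ge0 (mulr_ge0 Nge0 Dge0) lMge0).
    lra.
set S := (1 + _)%N.
(* The constant rounds up [329 * 13 + 409 * 4096 + 29 * 11 + 6]. *)
have sS : s%:R * S%:R <= 1700 * 1000 * (N * D).
  have b1 : s%:R * (T%:R * ((n %/ s).+1 * k)%:R) <= 13 * (N * D) :> R.
    by rewrite -!natrM ler_nat.
  have b2 : s%:R * (T%:R * (n.+1 * 2 ^ s)%:R) <= 4096 * (N * D) :> R.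
    by rewrite -!natrM ler_nat.
  have b3 : s%:R * T%:R <= 11 * (N * D) :> R by rewrite -!natrM ler_nat.
  have b4 : s%:R <= 6 * (N * D) :> R by rewrite -!natrM ler_nat.
  rewrite /S; move: ((n %/ s).+1 * k)%N b1 (n.+1 * 2 ^ s)%N b2 => u b1 w b2.
  rewrite !(natrD, natrM); lra.
have S0 : 0 <= S%:R :> R by [].
(* The gain [s] is at least a third of [log(m/n)] if [L] is not capped, and of [log d] if
   [L = 1024 * d]. *)
case: LE => e.
  apply: size_bound_left; first by rlra.
  apply: le_trans (_ : S%:R * (3 * s%:R) <= _); first by rewrite ler_wpM2l ?lgs.
  by rlra.
apply: size_bound_right; first by rlra.
apply: le_trans (_ : S%:R * (3 * s%:R) <= _); last by rlra.
rewrite ler_wpM2l //; apply: le_trans (_ : (2 * s + 2)%:R <= _).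
  apply: log2_leq; first by rlra.
  by rewrite ler_nat; apply: leq_trans (ltnW Ls); rewrite e leq_pmull.
by rewrite natrD natrM; rlra.
Qed.
End Bounds.

Theorem theorem1 :
  exists C : R, (0 < C)%R /\
  forall (n d m : nat), (1 <= n)%N -> (2 <= d)%N -> (6 * n <= m)%N ->
  forall (q : 'I_d -> bits n) (alpha : 'I_d -> CC),
    injective q ->
    (\sum_(i < d) `|alpha i| ^+ 2 = 1)%R ->
    exists c : circuit (n + m),
      circuit_ok c /\
      (forall x : bits (n + m),
         run c (ket (join (zeros n) (zeros m))) x
         = (\sum_(i < d) alpha i * ket (join (q i) (zeros m)) x)%R) /\
      (exists D : nat, depth_le c D /\
         (INR D <= C * (INR n * INR d * log2 (INR m) / (INR m * log2 (INR m / INR n))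
                        + log2 (INR n * INR d)))%R) /\
      (INR (csize c) <= C * (INR n * INR d / log2 (INR m / INR n)
                             + INR n * INR d / log2 (INR d)))%R.
Proof.
(* The largest demand is [700 * 10240], from the depth of the sequential case. *)
exists (10 * 1000 * 1000)%R; split; first by lra.
move=> n d m n0 d1 mn q al qI al1; rewrite !INRE.
have m0 : (0 < m)%N by apply: leq_trans mn; rewrite muln_gt0.
suff [c [Db [Sb [[cok crun cd cs] bd bs]]]] : exists c Db Sb,
    [/\ [/\ circuit_ok c,
        forall x, run c (ket (join (zeros n) (zeros m))) x =
          \sum_(i < d) al i * ket (join (q i) (zeros m)) x,
        depth_le c Db & (size c <= Sb)%N],
      Db%:R <= depth_bound n d m (10 * 1000 * 1000)%R &
      Sb%:R <= size_bound n d m (10 * 1000 * 1000)%R].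
  exists c; split=> //; split=> //; split; first by exists Db; split; rewrite ?INRE.
  by rewrite INRE; apply: le_trans bs; rewrite ler_nat.
have [mK|mK] := ltnP m (1024 * n).
  have [h [hn bd bs]] := sequential_bounds n0 d1 mn mK.
  have [|c [cok crun cd cs]] := prepare_sequential m0 qI al1 _ hn; first by lia.
  by exists c; do 2 eexists; split; [split; eassumption|exact: bd|exact: bs].
have d2n : (d <= 2 ^ n)%N.
  by have := leq_card q qI; rewrite card_ord card_ffun card_bool card_ord.
have [s [k [T [h [L [[s1 k0 T0 dT] [[f1 f2 f3 f4] [[a1 a2 a3 a4] [[b1 b2 b3 b4] [LE TE]]]]]]]]]] :=
  parameters n0 d1 d2n mK.
have [bd bs] := parallel_bounds n0 d1 mn s1 T0 a1 a2 a3 a4 b1 b2 b3 b4 LE TE.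
have [c [cok crun cd cs]] := prepare_parallel m0 qI al1 (ltnW s1) k0 dT f1 f2 f3 f4.
by exists c; do 2 eexists; split; [split; eassumption|exact: bd|exact: bs].
Qed.
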